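(* Let $\nu$ be a $\sigma$-finite nonatomic Borel measure on a compactum $X$ such that all nonempty open subsets of $X$ have positive $\nu$-measure, and let $\mu$ be a nonatomic Borel measure on a compactum $Y$ with $Y\notin J_f(\mu)$. Then for any $B\in Bor(Y)\setminus J_f(\mu)$ with $\mu(B)<\infty$ there is a Borel map $f:X\to B$ such that, whenever $A\in J_f(\mu)$, $f^{-1}(A)\in J_f(\nu)$.
   Context: A compactum is a compact metrizable space; $Bor(Y)$ is the $\sigma$-algebra of Borel sets in $Y$. A Borel measure on a compactum is a countably additive measure on its Borel sets with values in $[0,\infty]$. It is nonatomic if every Borel set $A$ of positive measure contains a Borel set of positive measure strictly smaller than that of $A$. For a Borel measure $\mu$ on a compactum $Y$, $J_f(\mu)$ is the $\sigma$-ideal of Borel sets in $Y$ that can be covered by countably many compact subsets of $Y$ of finite $\mu$-measure. *)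

(* Defs.v *)
From HB Require Import structures.
From mathcomp Require Import all_boot all_order all_algebra.
From mathcomp Require Import all_classical all_reals all_analysis.

Set Implicit Arguments.
Unset Strict Implicit.
Unset Printing Implicit Defensive.

Import Order.TTheory GRing.Theory Num.Theory.

Local Open Scope classical_set_scope.
Local Open Scope ring_scope.

(* [borel X] is [X] itself, equipped with its Borel sets as measurable sets.
   The library's measurable types are pointed, whence [ptopologicalType]. *)
Notation borel X := (g_sigma_algebraType (@open X)).

Definition metrizable (R : realType) (X : topologicalType) : Prop :=
  exists d : X -> X -> R,
    [/\ forall x y, d x y = 0 <-> x = y,
        forall x y, d x y = d y x,
        forall x y z, d x z <= d x y + d y z
      & forall x, nbhs x =
          filter_from [set e : R | 0 < e] (fun e => [set y | d x y < e])].

Definition compactum (R : realType) (X : topologicalType) : Prop :=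
  compact [set: X] /\ metrizable R X.

Definition nonatomic (d : measure_display) (T : measurableType d)
    (R : realType) (mu : {measure set T -> \bar R}) : Prop :=
  forall A : set T, measurable A -> (0 < mu A)%E ->
    exists C : set T,
      [/\ measurable C, C `<=` A, (0 < mu C)%E & (mu C < mu A)%E].

Definition Jf (R : realType) (Y : ptopologicalType)
    (mu : {measure set (borel Y) -> \bar R}) : set (set (borel Y)) :=
  [set A : set (borel Y) | measurable A /\
    exists K : nat -> set Y,
      (forall n, compact (K n) /\ (mu (K n) < +oo)%E) /\
      (A : set Y) `<=` \bigcup_n K n].

(* Main.v *)
Require Import Defs.
From HB Require Import structures.
From mathcomp Require Import all_boot all_order all_algebra.
From mathcomp Require Import lra.
From mathcomp Require Import all_classical all_reals all_analysis.

Set Implicit Arguments.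
Unset Strict Implicit.
Unset Printing Implicit Defensive.

Import Order.TTheory GRing.Theory Num.Theory.

Local Open Scope classical_set_scope.
Local Open Scope ring_scope.

(** Off a [nu]-null set [N], the space [X] is covered by countably many compact
    sets [E n] of finite measure, and [f] may be constant there. On [N], [f] is
    the limit of a scheme that matches a tree of Borel cells of [N] with a tree
    of closed cells of [Y]. The children of a node of level [n] come from a
    cover of [X \ E n] by balls shrinking towards [E n]; the matching cells of
    [Y] carry pieces of [B] outside [Jf mu], hence with closure of infinite
    measure, and shrink towards a compact set [L] in that closure with
    [nu (E n) < mu L < +oo]. Since [nu] is nonatomic, a Cantor scheme on [E n]
    and [L] allows one to place them in such a way that a closed set [K] meeting
    the cells with indices in [I] satisfies [mu (K `&` L) + e >= nu Z] with [Z]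
    the set of limits in [E n] of the balls with indices in [I]. The sets [L] of
    distinct nodes are disjoint, so that, summing over the nodes, the closure of
    [N `&` f @^-1` K] has measure at most [mu K + 1]. The map takes its values
    in [B] because the pieces of [B] follow a Souslin scheme of closed sets. *)

Definition metrizes (R : realType) (X : topologicalType) (d : X -> X -> R) :=
  [/\ forall x y, d x y = 0 <-> x = y,
      forall x y, d x y = d y x,
      forall x y z, d x z <= d x y + d y z
    & forall x, nbhs x =
        filter_from [set e : R | 0 < e] (fun e => [set y | d x y < e])].

(** * Compact metric spaces *)

Lemma invS_small (R : realType) (e : R) : 0 < e ->
  exists m, forall i, (m <= i)%N -> i.+1%:R^-1 < e.
Proof.
move=> e0; exists (Num.trunc e^-1) => i mi; rewrite invf_plt ?posrE//.
by rewrite (lt_le_trans (truncnS_gt _))// ler_nat ltnS.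
Qed.

Section metric.
Variables (R : realType) (X : ptopologicalType) (d : X -> X -> R).
Hypothesis dX : metrizes d.

Lemma dist_xx x : d x x = 0.
Proof. by case: dX => h _ _ _; apply/h. Qed.

Lemma dist_sym x y : d x y = d y x.
Proof. by case: dX. Qed.

Lemma dist_triangle x y z : d x z <= d x y + d y z.
Proof. by case: dX. Qed.

Lemma dist_ge0 x y : 0 <= d x y.
Proof.
have := dist_triangle x y x; rewrite dist_xx (dist_sym y x) -mulr2n.
by rewrite pmulrn_lge0.
Qed.

Lemma dist_eq0 x y : d x y = 0 -> x = y.
Proof. by case: dX => h _ _ _ /h. Qed.

Lemma nbhs_distP x (A : set X) :
  nbhs x A <-> exists2 e, 0 < e & forall y, d x y < e -> A y.
Proof.
case: dX => _ _ _ ->; split=> -[e e0 eA]; exists e => //.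
Qed.

Lemma open_distP (A : set X) :
  open A <-> forall x, A x -> exists2 e, 0 < e & forall y, d x y < e -> A y.
Proof.
rewrite openE; split=> [oA x Ax|oA x Ax].
  by apply/nbhs_distP; apply: oA.
by apply/nbhs_distP; apply: oA.
Qed.

Lemma open_distball x e : open [set y | d x y < e].
Proof.
apply/open_distP => y /= xy; exists (e - d x y); first by rewrite subr_gt0.
by move=> z yz; rewrite (le_lt_trans (dist_triangle x y z))// addrC -ltrBrDr.
Qed.

Lemma closed_distP (A : set X) :
  closed A <-> forall x, (forall e, 0 < e -> exists2 a, A a & d x a < e) -> A x.
Proof.
split=> [cA x h|h x xA].
  apply: cA => B /nbhs_distP[e e0 eB]; have [a Aa xa] := h _ e0.
  by exists a; split => //; apply: eB.
apply: h => e e0; have /xA[a [Aa xa]] : nbhs x [set y | d x y < e].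
  by apply/nbhs_distP; exists e.
by exists a.
Qed.

Lemma closure_distP (A : set X) x :
  closure A x <-> forall e, 0 < e -> exists2 a, A a & d x a < e.
Proof.
split=> [xA e e0|h B /nbhs_distP[e e0 eB]].
  have /xA[a [Aa xa]] : nbhs x [set y | d x y < e].
    by apply/nbhs_distP; exists e.
  by exists a.
by have [a Aa xa] := h _ e0; exists a; split => //; apply: eB.
Qed.

Lemma closed_distball x e : closed [set y | d x y <= e].
Proof.
apply/closed_distP => y h /=; rewrite leNgt; apply/negP => xy.
have [a /= xa ya] := h (d x y - e) ltac:(by rewrite subr_gt0).
have := dist_triangle x a y; rewrite leNgt (dist_sym a)=> /negP; apply.
by rewrite -(subrK e (d x y)) addrC ltr_leD.
Qed.

Lemma hausdorff_dist : hausdorff_space X.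
Proof.
move=> x y xy; apply: dist_eq0; apply/eqP; rewrite eq_le dist_ge0 andbT.
apply/ler_addgt0Pl => e e0; rewrite addr0.
have e2 : 0 < e / 2 by rewrite divr_gt0.
have [z /= [xz yz]] : [set z | d x z < e / 2] `&` [set z | d y z < e / 2] !=set0.
  by apply: xy; apply/nbhs_distP; exists (e / 2).
rewrite (le_trans (dist_triangle x z y))// (splitr e) lerD// ltW//.
by rewrite dist_sym.
Qed.

Lemma compact_cluster_seq (u : nat -> X) : compact [set: X] ->
  exists x, forall e, 0 < e -> forall m, exists2 n, (m <= n)%N & d x (u n) < e.
Proof.
move=> cX; have [|x [_ ux]] := cX (u @ \oo) _; first exact: filterT.
exists x => e e0 m.
have [||z [[n /= mn <-] xz]] := ux [set u n | n in [set n | (m <= n)%N]] [set z | d x z < e].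
- by exists m => // n mn; exists n.
- by apply/nbhs_distP; exists e.
- by exists n.
Qed.

Hypothesis cX : compact [set: X].

(** Points of [A] at distance less than [1/(m+1)] from [B] cluster by compactness, and a cluster
    point lies in both closed sets. *)
Lemma closed_meets_of_dist (A B : set X) : closed A -> closed B ->
  (forall e, 0 < e -> exists a b, [/\ A a, B b & d a b < e]) -> A `&` B !=set0.
Proof.
move=> /closed_distP cA /closed_distP cB AB.
have /choice[u hu] (m : nat) : exists a, A a /\ exists2 b, B b & d a b < m.+1%:R^-1.
  have [a [b [Aa Bb ab]]] := AB m.+1%:R^-1 ltac:(by []).
  by exists a; split => //; exists b.
have [x ux] := compact_cluster_seq u cX; exists x; split.
  by apply: cA => e /ux /(_ 0%N)[n _ xn]; exists (u n) => //; case: (hu n).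
apply: cB => e e0; have e2 : 0 < e / 2 by rewrite divr_gt0.
have [m hm] := invS_small e2; have [n mn xn] := ux _ e2 m.
have [_ [b Bb ub]] := hu n; exists b => //.
rewrite (le_lt_trans (dist_triangle _ (u n) _))// (splitr e) ltrD//.
exact: lt_trans (hm _ mn).
Qed.

Lemma dense_seq_exists :
  exists p : nat -> X, forall x e, 0 < e -> exists n, d (p n) x < e.
Proof.
have /choice[F hF] (k : nat) : exists s : seq X, forall x, exists2 y, y \in s & d y x < k.+1%:R^-1.
  have := cX; rewrite compact_cover => /(_ X setT (fun y => [set x | d y x < k.+1%:R^-1])).
  case=> [y _|y _|s _ hs]; first exact: open_distball.
    by exists y => //=; rewrite dist_xx.
  exists (finmap.enum_fset s) => x; have [y /= ys yx] := hs x I.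
  by exists y.
pose p m := if @unpickle (nat * nat)%type m is Some (k, j) then nth point (F k) j else point.
exists p => x e /invS_small[m /(_ _ (leqnn m)) me].
have [y ys yx] := hF m x; exists (pickle (m, index y (F m))).
by rewrite /p pickleK nth_index// (lt_trans yx).
Qed.

(** Balls of radius [1/(j+1)] around a dense sequence, numbered by [pickle]. The closure clause
    makes open sets F-sigma and, in [transport], separates a point from a closed set. *)
Lemma countable_base_exists :
  exists U : nat -> set X, (forall n, open (U n)) /\
    forall V x, open V -> V x -> exists2 n, U n x & closure (U n) `<=` V.
Proof.
have [p hp] := dense_seq_exists.
pose U m := if @unpickle (nat * nat)%type m is Some (k, j)
  then [set y | d (p k) y < j.+1%:R^-1] else set0.
exists U; split=> [n|V x /open_distP oV /oV[e e0 eV]].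
  by rewrite /U; case: unpickle => [[k j]|]; [exact: open_distball|exact: open0].
have e2 : 0 < e / 2 by rewrite divr_gt0.
have [j /(_ _ (leqnn j)) je] := invS_small e2.
have [k kx] := hp x j.+1%:R^-1 ltac:(by []).
exists (pickle (k, j)); first by rewrite /U pickleK.
rewrite /U pickleK => z zU; apply: eV.
rewrite (le_lt_trans (dist_triangle _ (p k) _))// (splitr e) ltr_leD//.
  by rewrite dist_sym (lt_trans kx).
apply: le_trans (ltW je).
apply: (@closed_distball (p k)); apply: closure_subset zU => y /=.
exact: ltW.
Qed.
Lemma open_Fsigma (U : set X) : open U ->
  exists2 E : nat -> set X, (forall n, closed (E n)) & U = \bigcup_n E n.
Proof.
move=> oU; have [B [_ hB]] := countable_base_exists.
exists (fun n => if pselect (closure (B n) `<=` U) then closure (B n) else set0).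
  by move=> n; case: pselect => ? /=; [exact: closed_closure|exact: closed0].
apply/seteqP; split => [x /(hB _ _ oU)[n Bx BU]|x [n _]].
  by exists n => //; case: pselect => //= ?; exact: subset_closure.
by case: pselect => //= h /h.
Qed.

End metric.

(** * Borel measures *)

Section measure_aux.
Context d (T : measurableType d) (R : realType) (mu : {measure set T -> \bar R}).
Local Open Scope ereal_scope.

Lemma mu_subset (A B : set T) : measurable A -> measurable B -> A `<=` B ->
  mu A <= mu B.
Proof. by move=> mA mB AB; rewrite le_measure// inE. Qed.

Lemma lt_mu_bigcup (F : (set T)^nat) (c : \bar R) :
  (forall n, measurable (F n)) -> nondecreasing_seq F ->
  c < mu (\bigcup_n F n) -> exists n, c < mu (F n).
Proof.
move=> mF ndF cF; apply: contrapT => /forallNP nF.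
have := @nondecreasing_cvg_mu _ _ _ mu _ mF (bigcupT_measurable F mF) ndF.
move=> /[dup] /cvgP cv /cvg_lim E.
have : lim (mu \o F @ \oo) <= c.
  by apply: lime_le => //; near=> n; rewrite leNgt; apply/negP/nF.
by rewrite E ?leNgt ?cF//; exact: ereal_hausdorff.
Unshelve. all: by end_near. Qed.

Lemma mu_bigcap_lt (F : (set T)^nat) (c : \bar R) :
  mu (F 0%N) < +oo -> (forall n, measurable (F n)) -> nonincreasing_seq F ->
  mu (\bigcap_n F n) < c -> exists n, mu (F n) < c.
Proof.
move=> F0 mF ndF cF; apply: contrapT => /forallNP nF.
have := nonincreasing_cvg_mu F0 mF (bigcapT_measurable mF) ndF.
move=> /[dup] /cvgP cv /cvg_lim E.
have : c <= lim (mu \o F @ \oo).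
  by apply: lime_ge => //; near=> n; rewrite leNgt; apply/negP/nF.
by rewrite E ?leNgt ?cF//; exact: ereal_hausdorff.
Unshelve. all: by end_near. Qed.

Lemma mu_lt_pinfty_split (A B : set T) : measurable A -> measurable B ->
  mu B < +oo -> mu (A `\` B) < +oo -> mu A < +oo.
Proof.
move=> mA mB Boo ABoo; rewrite (measureDI _ mA mB) lte_add_pinfty//.
by rewrite (le_lt_trans _ Boo)// measureIr.
Qed.

End measure_aux.

Lemma open_measurable_borel (X : ptopologicalType) (U : set X) :
  open U -> measurable (U : set (borel X)).
Proof. by move=> oU; apply: sub_gen_smallest. Qed.

Lemma closed_measurable_borel (X : ptopologicalType) (F : set X) :
  closed F -> measurable (F : set (borel X)).
Proof.
move=> cF; rewrite -[X in measurable X]setCK; apply: measurableC.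
by apply: open_measurable_borel; exact: closed_openC.
Qed.

#[local] Hint Resolve open_measurable_borel closed_measurable_borel : core.

(** * Inner regularity by closed sets *)

Section regularity.
Variables (R : realType) (X : ptopologicalType) (d : X -> X -> R).
Hypotheses (dX : metrizes d) (cX : compact [set: X]).
Variable mu : {measure set (borel X) -> \bar R}.

Section inner.
Variable A : set (borel X).
Hypotheses (mA : measurable A) (Aoo : (mu A < +oo)%E).

(** The error is measured inside the fixed [A] of finite measure, so that continuity from above is
    available even where [mu] is infinite. *)
Let inner (E : set X) := forall e : R, 0 < e -> exists F : set X,
  [/\ closed F, F `<=` E & (mu (A `&` (E `\` F) : set (borel X)) <= e%:E)%E].

Let inner_closed F : closed F -> inner F.
Proof.
move=> cF e e0; exists F; split => //.
by rewrite setDv setI0 measure0 lee_fin ltW.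
Qed.

Let inner_bigcap (E : (set X)^nat) :
  (forall n, measurable (E n : set (borel X))) ->
  (forall n, inner (E n)) -> inner (\bigcap_n E n).
Proof.
move=> mE iE e e0; have e2 n : 0 < e / (2 ^ n.+1)%:R by rewrite divr_gt0// ltr0n expn_gt0.
have /choice[F hF] n := iE n _ (e2 n).
have cF n : closed (F n) by have [] := hF n.
exists (\bigcap_n F n); split.
- by apply: closed_bigI => n _.
- by move=> x Fx n _; have [_ + _] := hF n; apply; apply: Fx.
apply: le_trans (epsilon_trick0 xpredT (ltW e0)).
apply: (@le_trans _ _ (\sum_(n <oo) mu (A `&` (E n `\` F n) : set (borel X)))%E).
  apply: measure_sigma_subadditive.
  - by move=> n; apply: measurableI => //; apply: measurableD => //; exact: closed_measurable_borel.
  - apply: measurableI => //; apply: measurableD; first exact: bigcapT_measurable.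
    by apply: bigcapT_measurable => n; exact: closed_measurable_borel.
  - move=> x [Ax [Ex nFx]]; apply: contrapT => nx; apply: nFx => n _.
    by apply: contrapT => Fx; apply: nx; exists n => //; split => //; split => //; exact: Ex.
by apply: lee_nneseries => // n _; have [] := hF n.
Qed.

Let inner_bigcup (E : (set X)^nat) :
  (forall n, measurable (E n : set (borel X))) ->
  (forall n, inner (E n)) -> inner (\bigcup_n E n).
Proof.
move=> mE iE e e0.
(* With total loss [e / 2] the limit of the decreasing [D n] lies strictly below [e], hence so does
   some [D n]; thus finitely many [F i] suffice, and their union is closed. *)
have h0 : 0 < e / 2 by rewrite divr_gt0.
have e2 n : 0 < e / 2 / (2 ^ n.+1)%:R by rewrite divr_gt0// ltr0n expn_gt0.
have /choice[F hF] n := iE n _ (e2 n).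
have cF n : closed (F n) by have [] := hF n.
have mF n : measurable (F n : set (borel X)) by exact: closed_measurable_borel.
pose D n : set (borel X) := A `&` (\bigcup_n E n `\` \bigcup_(i < n) F i).
have mD n : measurable (D n).
  apply: measurableI => //; apply: measurableD; first exact: bigcupT_measurable.
  exact: bigcup_measurable.
have Doo : (mu (\bigcap_n D n) < e%:E)%E.
  apply: (@le_lt_trans _ _ (e / 2)%:E); last first.
    by rewrite lte_fin ltr_pdivrMr// ltr_pMr// ltr1n.
  apply: le_trans (epsilon_trick0 xpredT (ltW h0)).
  apply: (@le_trans _ _ (\sum_(n <oo) mu (A `&` (E n `\` F n) : set (borel X)))%E).
    apply: measure_sigma_subadditive.
    + by move=> n; apply: measurableI => //; apply: measurableD.
    + exact: bigcapT_measurable.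
    + move=> x Dx; have [Ax [[n _ Ex] _]] := Dx 0%N I.
      exists n => //; split => //; split => // Fx.
      by have [_ [_]] := Dx n.+1 I; apply; exists n => //=.
  by apply: lee_nneseries => // n _; have [] := hF n.
have [|//||n Dn] := mu_bigcap_lt _ _ _ Doo.
- by rewrite (le_lt_trans _ Aoo)// mu_subset// => x [].
- move=> m n mn; apply/subsetPset => x [Ax [Ex nF]]; split => //; split => //.
  by move=> [i /= im Fx]; apply: nF; exists i => //=; exact: leq_trans mn.
exists (\bigcup_(i < n) F i); split; last exact: ltW.
- by apply: closed_bigcup => //; exact: finite_II.
- by move=> x [i _ Fx]; exists i => //; have [_ + _] := hF i; apply.
Qed.

(** Sets that can be approximated together with their complement form a sigma-algebra; open sets
    belong to it because they are F-sigma. *)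
Lemma inner_regular_in (E : set (borel X)) : measurable E -> inner E.
Proof.
pose G : set (set X) :=
  [set E | [/\ measurable (E : set (borel X)), inner E & inner (~` E)]].
suff sG : <<s @open X >> `<=` G by move=> mE; have [] := sG _ mE.
apply: smallest_sub.
  split.
  - split; [exact: measurable0|exact/inner_closed/closed0|].
    by rewrite setC0; apply/inner_closed/closedT.
  - move=> E' [mE iE iCE]; rewrite setTD; split => //; first exact: measurableC.
    by rewrite setCK.
  - move=> E' hE; split; first by apply: bigcupT_measurable => n; have [] := hE n.
      by apply: (@inner_bigcup E') => n; case: (hE n).
    rewrite setC_bigcup; apply: (@inner_bigcap (fun n => ~` E' n)) => n; case: (hE n) => // mE _ _.
    exact: measurableC.
move=> U oU; split; first exact: open_measurable_borel.
  have [E' cE ->] := open_Fsigma dX cX oU.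
  apply: inner_bigcup => n; first exact: closed_measurable_borel.
  exact: inner_closed.
by apply: inner_closed; exact: open_closedC.
Qed.

Lemma inner_regular (e : R) : 0 < e ->
  exists F : set X, [/\ closed F, F `<=` A & (mu (A `\` F : set (borel X)) <= e%:E)%E].
Proof.
move=> /(inner_regular_in mA)[F [cF FA h]]; exists F; split => //.
by rewrite -[X in mu X](_ : A `&` (A `\` F) = _)// setIDA setIid.
Qed.
End inner.
End regularity.

(** * Borel sets and the Souslin operation *)

Lemma mkseq_cons T (a : nat -> T) n : mkseq a n.+1 = a 0%N :: mkseq (a \o S) n.
Proof.
apply: (@eq_from_nth _ (a 0%N)); first by rewrite /= !size_map !size_iota.
rewrite size_mkseq => -[|i] ni; first by rewrite nth_mkseq.
by rewrite nth_mkseq//= nth_mkseq.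
Qed.

(** The Souslin operation applied to a scheme of closed sets. Nodes of the scheme list their entries
    with the earliest first. *)
Definition souslin (Y : topologicalType) (F : seq nat -> set Y) (A : set Y) :=
  (forall s, closed (F s)) /\
  forall y, A y <-> exists a : nat -> nat, forall n, F (mkseq a n) y.

Section souslin.
Variable Y : topologicalType.

Lemma souslin_closed (A : set Y) : closed A -> exists F, souslin F A.
Proof.
move=> cA; exists (fun=> A); split => // y; split => [Ay|[a /(_ 0%N)]//].
by exists (fun=> 0%N).
Qed.

Lemma souslin_bigcup (A : (set Y)^nat) : (forall k, exists F, souslin F (A k)) ->
  exists F, souslin F (\bigcup_k A k).
Proof.
move=> /choice[F hF].
exists (fun s => if s is k :: s' then F k s' else setT); split.
  by case=> [|k s]; [exact: closedT|exact: (hF k).1].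
move=> y; split.
  move=> [k _ /(hF k).2[a ha]]; exists (fun n => if n is n'.+1 then a n' else k).
  case=> [//|n]; rewrite mkseq_cons.
  exact: (ha n).
move=> [a ha]; exists (a 0%N) => //; apply/(hF _).2; exists (a \o S) => n.
have -> : mkseq (a \o S) n = behead (mkseq a n.+1) by rewrite mkseq_cons.
exact: (ha n.+1).
Qed.

Lemma souslin_bigcap (A : (set Y)^nat) : (forall k, exists F, souslin F (A k)) ->
  exists F, souslin F (\bigcap_k A k).
Proof.
move=> /choice[F hF].
(* One branch codes a branch for every [k] through the pairing [pickle]; [D s] holds the pairs
   [(k, n)] for which [s] already determines the first [n] entries of the branch for [k]. *)
pose D (s : seq nat) : set (nat * nat) :=
  [set p | forall j, (j < p.2)%N -> (pickle (p.1, j) < size s)%N].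
exists (fun s => \bigcap_(p in D s)
  F p.1 (mkseq (fun j => nth 0%N s (pickle (p.1, j))) p.2)); split.
  by move=> s; apply: closed_bigI => p _; exact: (hF _).1.
have mkE (a : nat -> nat) m (p : nat * nat) : D (mkseq a m) p ->
    mkseq (fun j => nth 0%N (mkseq a m) (pickle (p.1, j))) p.2 =
    mkseq (fun j => a (pickle (p.1, j))) p.2.
  move=> Dp; apply/eq_in_map => j; rewrite mem_iota add0n => /= jp.
  by rewrite nth_mkseq//; have := Dp _ jp; rewrite size_mkseq.
move=> y; split.
  move=> Ay; have /choice[a ha] k : exists a, forall n, F k (mkseq a n) y.
    by apply/(hF k).2; exact: Ay.
  exists (fun m => if @unpickle (nat * nat)%type m is Some (k, j) then a k j else 0%N).
  move=> n p Dp; rewrite mkE//.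
  rewrite (_ : mkseq _ _ = mkseq (a p.1) p.2)//.
  by apply: eq_mkseq => j; rewrite pickleK.
move=> [a ha] k _; apply/(hF k).2; exists (fun j => a (pickle (k, j))) => n.
(* The prefix of length [m] reaches the codes of all [(k, j)] with [j < n]. *)
pose m := (\max_(j < n) (pickle (k, nat_of_ord j)).+1)%N.
have Dm : D (mkseq a m) (k, n).
  move=> j /= jn; rewrite size_mkseq.
  exact: (@leq_bigmax _ (fun j : 'I_n => (pickle (k, nat_of_ord j)).+1) (Ordinal jn)).
by have := ha m _ Dm; rewrite mkE.
Qed.

End souslin.

(** Sets that are Souslin together with their complement form a sigma-algebra, which contains the
    open sets since these are F-sigma. *)
Lemma borel_souslin (R : realType) (Y : ptopologicalType) (d : Y -> Y -> R) :
  metrizes d -> compact [set: Y] ->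
  forall A : set (borel Y), measurable A -> exists F, souslin F (A : set Y).
Proof.
move=> dY cY.
pose G : set (set Y) :=
  [set E | (exists F, souslin F E) /\ (exists F, souslin F (~` E))].
suff sG : <<s @open Y >> `<=` G by move=> A mA; have [] := sG _ mA.
apply: smallest_sub.
  split.
  - by split; [exact/souslin_closed/closed0|rewrite setC0; exact/souslin_closed/closedT].
  - by move=> E [sE sCE]; rewrite setTD; split => //; rewrite setCK.
  - move=> E hE; split; first by apply: souslin_bigcup => n; case: (hE n).
    by rewrite setC_bigcup; apply: souslin_bigcap => n; case: (hE n).
move=> U oU; split; last exact/souslin_closed/open_closedC.
have [E' cE' ->] := open_Fsigma dY cY oU.
by apply: souslin_bigcup => n; exact: souslin_closed.
Qed.

(** * Nonatomic measures *)

Section nonatomic_semifinite.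
Context dd (T : measurableType dd) (R : realType) (mu : {measure set T -> \bar R}).
Hypothesis mu_nonatomic : nonatomic mu.
Local Open Scope ereal_scope.

Lemma nonatomic_set1 (x : T) : measurable [set x] -> mu [set x] = 0.
Proof.
move=> mx; apply/eqP; rewrite -measure_le0 leNgt; apply/negP.
move=> /(mu_nonatomic mx)[C [mC Cx C0]]; have [Cx'|nCx] := pselect (C x).
  by rewrite (_ : C = [set x]) ?ltxx//; apply/seteqP; split => // _ ->.
suff C00 : C = set0 by rewrite C00 measure0 ltxx in C0.
by rewrite -subset0 => y /[dup] /Cx -> /nCx.
Qed.

(** Exhaustion: if the finite measures of subsets of [H] were bounded, a countable union of subsets
    would attain their supremum. The rest of [H] still has positive measure, and a subset of it of
    strictly smaller positive measure is finite and can be added, exceeding the supremum. *)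
Lemma nonatomic_semifinite (H : set T) (c : R) : measurable H -> mu H = +oo ->
  exists C, [/\ measurable C, C `<=` H, c%:E < mu C & mu C < +oo].
Proof.
move=> mH Hoo; apply: contrapT => nC.
pose S := [set fine (mu C) | C in [set C | [/\ measurable C, C `<=` H & mu C < +oo]]].
have mu_fin C : mu C < +oo -> mu C = (fine (mu C))%:E.
  by move=> Coo; rewrite fineK// ge0_fin_numE.
have S0 : S 0%R by exists set0; [split => //; rewrite measure0|rewrite measure0].
have supS : has_sup S.
  split; first by exists 0%R.
  exists c => _ [C [mC CH Coo] <-]; rewrite leNgt; apply/negP => cC; apply: nC.
  by exists C; split => //; rewrite mu_fin// lte_fin.
have leM C : measurable C -> C `<=` H -> mu C < +oo -> mu C <= (sup S)%:E.
  move=> mC CH Coo; rewrite mu_fin// lee_fin; apply: ub_le_sup; first exact: supS.2.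
  by exists C.
have /choice[C hC] (n : nat) : exists C, [/\ measurable C, C `<=` H, mu C < +oo &
    (sup S - n.+1%:R^-1)%:E < mu C].
  have [_ [C [mC CH Coo] <-]] := @sup_adherent _ S _ (ltac:(by []) : (0 < n.+1%:R^-1 :> R)%R) supS.
  by rewrite -lte_fin -mu_fin// => h; exists C.
have mC n : measurable (C n) by case: (hC n).
pose D n := \bigcup_(i < n) C i.
have mD n : measurable (D n) by apply: bigcup_measurable.
have Doo n : mu (D n) < +oo.
  elim: n => [|n IH]; first by rewrite /D bigcup_mkord big_ord0 measure0.
  rewrite /D bigcup_mkord big_ord_recr/= -bigcup_mkord -/(D n).
  apply: le_lt_trans (measureU2 _ (mD n) (mC n)) _.
  by rewrite lte_add_pinfty//; case: (hC n).
have bD : \bigcup_n D n = \bigcup_n C n.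
  apply/seteqP; split => [x [n _ [i _ Cx]]|x [n _ Cx]]; first by exists i.
  by exists n.+1 => //; exists n => /=.
have CH : \bigcup_n C n `<=` H by move=> x [n _]; case: (hC n) => _ + _ _; apply.
have mbC : measurable (\bigcup_n C n) by exact: bigcupT_measurable.
have bC : mu (\bigcup_n C n) <= (sup S)%:E.
  rewrite leNgt; apply/negP; rewrite -bD => /lt_mu_bigcup[//||n].
    by move=> m n mn; apply/subsetPset => x [i /= im Cx]; exists i => //=; exact: leq_trans mn.
  rewrite ltNge leM//; apply: subset_trans CH; rewrite -bD.
  exact: bigcup_sup.
have Cb : (sup S)%:E <= mu (\bigcup_n C n).
  rewrite (mu_fin (\bigcup_n C n)) ?(le_lt_trans bC) ?ltry// lee_fin leNgt; apply/negP => lt.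
  have gap : (0 < sup S - fine (mu (\bigcup_n C n)))%R by rewrite subr_gt0.
  have [n /(_ _ (leqnn n)) hn] := invS_small gap.
  have [_ _ _] := hC n.
  rewrite ltNge => /negP; apply.
  rewrite (le_trans (mu_subset _ _ _ (@bigcup_sup _ _ n setT C I)))//.
  rewrite mu_fin ?(le_lt_trans bC) ?ltry// lee_fin; rewrite lerBrDr -lerBrDl.
  exact: ltW.
have HC : 0 < mu (H `\` \bigcup_n C n).
  rewrite lt0e measure_ge0 andbT; apply/eqP => HC0.
  suff : mu H < +oo by rewrite Hoo ltxx.
  by apply: mu_lt_pinfty_split mbC _ _ => //; rewrite ?(le_lt_trans bC) ?ltry// HC0.
have [|E [mE EH E0 Eoo]] := mu_nonatomic _ HC; first exact: measurableD.
have {}Eoo : mu E < +oo by rewrite (lt_le_trans Eoo)// leey.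
suff : mu (\bigcup_n C n `|` E) <= (sup S)%:E.
  rewrite measureU//.
    move=> h; have := lte_leD _ E0 Cb; rewrite add0e addeC.
    by move=> /(_ ltac:(by []))/lt_le_trans /(_ h); rewrite ltxx.
  by rewrite -subset0 => x [Cx /EH[]].
apply: leM; first exact: measurableU.
  by move=> x [/CH//|/EH[]].
apply: le_lt_trans (measureU2 _ mbC mE) _.
by rewrite lte_add_pinfty// (le_lt_trans bC)// ltry.
Qed.
End nonatomic_semifinite.

(** * Closed subsets and intermediate values of a nonatomic measure *)

Section splitting.
Variables (R : realType) (X : ptopologicalType) (d : X -> X -> R).
Hypotheses (dX : metrizes d) (cX : compact [set: X]).
Variable nu : {measure set (borel X) -> \bar R}.

Lemma inner_regular_lt (A : set (borel X)) (c : R) :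
  measurable A -> (nu A < +oo)%E -> (c%:E < nu A)%E ->
  exists F : set X, [/\ closed F, F `<=` A & (c%:E < nu (F : set (borel X)))%E].
Proof.
move=> mA Aoo cA; have Af : nu A = (fine (nu A))%:E by rewrite fineK// ge0_fin_numE.
have e0 : 0 < (fine (nu A) - c) / 2 by rewrite divr_gt0// subr_gt0 -lte_fin -Af.
have [F [cF FA AF]] := inner_regular dX cX mA Aoo e0.
have mF : measurable (F : set (borel X)) by exact: closed_measurable_borel.
exists F; split => //.
have : (nu A <= nu (F : set (borel X)) + ((fine (nu A) - c) / 2)%:E)%E.
  by rewrite {1}(measureDI _ mA mF) setIidr// addeC leeD.
have Foo : (nu (F : set (borel X)) < +oo)%E by rewrite (le_lt_trans _ Aoo)// mu_subset.
have Ff : nu (F : set (borel X)) = (fine (nu (F : set (borel X))))%:E.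
  by rewrite fineK// ge0_fin_numE.
move: Af Ff e0 cA; set a := fine _; set b := fine _ => -> -> e0.
by rewrite -EFinD lee_fin !lte_fin => ca ab; lra.
Qed.

Lemma nonatomic_semifinite_closed (H : set X) (c : R) : nonatomic nu ->
  closed H -> nu (H : set (borel X)) = +oo%E ->
  exists L : set X, [/\ closed L, L `<=` H, (c%:E < nu (L : set (borel X)))%E
    & (nu (L : set (borel X)) < +oo)%E].
Proof.
move=> na cH Hoo.
have [|C [mC CH cC Coo]] := @nonatomic_semifinite _ _ _ _ na H c _ Hoo.
  exact: closed_measurable_borel.
have [L [cL LC cL']] := inner_regular_lt mC Coo cC.
exists L; split => //; first exact: subset_trans CH.
by rewrite (le_lt_trans _ Coo)// mu_subset//; exact: closed_measurable_borel.
Qed.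

Hypothesis nu_nonatomic : nonatomic nu.

(** Countably many pieces of measure less than [c - s] cover [P]. Adding them one by one, the first
    partial union of measure above [s] stays below [c]. *)
Lemma nonatomic_intermediate (P : set (borel X)) (s c : R) :
  measurable P -> (nu P < +oo)%E -> 0 <= s -> s < c -> (s%:E < nu P)%E ->
  exists P', [/\ measurable P', P' `<=` P, (s%:E < nu P')%E & (nu P' < c%:E)%E].
Proof.
move=> mP Poo s0 sc sP; have [B [oB hB]] := countable_base_exists dX cX.
have mPB k : measurable (P `&` (B k : set (borel X))).
  by apply: measurableI => //; exact: open_measurable_borel.
pose V k : set (borel X) :=
  if (nu (P `&` (B k : set (borel X))) < (c - s)%:E)%E then P `&` B k else set0.
have mV k : measurable (V k) by rewrite /V; case: ifP.
have Vcs k : (nu (V k) < (c - s)%:E)%E.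
  by rewrite /V; case: ifP => // _; rewrite measure0 lte_fin subr_gt0.
pose W n := \bigcup_(i < n) V i.
have mW n : measurable (W n) by exact: bigcup_measurable.
have WP : \bigcup_n W n = P.
  apply/seteqP; split => [x [n _ [i _]]|x Px].
    by rewrite /V; case: ifP => // _ [].
  (* The traces on [P] of balls around [x] shrink to a null set, a singleton at most, so some basic
     set around [x] is small enough to be kept in [V]. *)
  pose b n : set (borel X) := P `&` [set y | d x y < n.+1%:R^-1].
  have mb n : measurable (b n).
    apply: measurableI => //; apply: open_measurable_borel; exact: open_distball.
  have [||||n bn] := @mu_bigcap_lt _ _ _ nu b (c - s)%:E.
  - by rewrite (le_lt_trans _ Poo)// mu_subset// => y [].
  - by [].
  - move=> m n mn; apply/subsetPset => y [Py /= xy]; split => //=.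
    by rewrite (lt_le_trans xy)// lef_pV2 ?posrE// ler_nat.
  - have m1 : measurable ([set x] : set (borel X)).
      apply: closed_measurable_borel; apply: accessible_closed_set1.
      by apply: hausdorff_accessible; exact: hausdorff_dist dX.
    apply: (@le_lt_trans _ _ (nu ([set x] : set (borel X)))); last first.
      by rewrite nonatomic_set1// lte_fin subr_gt0.
    apply: mu_subset => //; first exact: bigcapT_measurable.
    move=> y yb; apply/esym/(dist_eq0 dX)/eqP; rewrite eq_le (dist_ge0 dX) andbT.
    rewrite leNgt; apply/negP => /invS_small[m /(_ _ (leqnn m))].
    by have [_ /= /lt_trans h /h] := yb m I; rewrite ltxx.
  have [|k Bx Bb] := hB _ x (open_distball dX x n.+1%:R^-1).
    by rewrite /= (dist_xx dX).
  exists k.+1 => //; exists k => //=; rewrite /V ifT//.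
  apply: le_lt_trans bn; apply: mu_subset => // y [Py By]; split => //.
  exact/Bb/subset_closure.
have [//|||n0 hn0] := @lt_mu_bigcup _ _ _ nu W s%:E.
  by move=> m n mn; apply/subsetPset => x [i /= im Vx]; exists i => //=; exact: leq_trans mn.
  by rewrite WP.
have ex : exists n, (s%:E < nu (W n))%E by exists n0.
case: (ex_minnP ex) => -[|m] sW min.
  by move: sW; rewrite /W bigcup_mkord big_ord0 measure0 lte_fin ltNge s0.
exists (W m.+1); split => //.
  by rewrite -WP; exact: bigcup_sup.
rewrite /W bigcup_mkord big_ord_recr/= -bigcup_mkord -/(W m).
apply: le_lt_trans (measureU2 _ (mW m) (mV m)) _.
have Wm : (nu (W m) <= s%:E)%E.
  by rewrite leNgt; apply/negP => /min; rewrite ltnn.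
rewrite (le_lt_trans (leeD2r _ Wm))//.
by rewrite -[c](subrKC s) EFinD lteD2lE//; exact: Vcs.
Qed.
End splitting.

(** * Matching closed sets of finite measure *)

Section split_pair.
Variables (R : realType) (X Y : ptopologicalType).
Variables (dX : X -> X -> R) (dY : Y -> Y -> R).
Hypotheses (mX : metrizes dX) (cX : compact [set: X]).
Hypotheses (mY : metrizes dY) (cY : compact [set: Y]).
Variables (nu : {measure set (borel X) -> \bar R}).
Variables (mu : {measure set (borel Y) -> \bar R}).
Hypothesis nu_nonatomic : nonatomic nu.
Local Open Scope ereal_scope.

(** Strictness leaves room for approximation by closed sets from inside; the alternative [P = set0]
    admits a null or empty [Q]. *)
Definition dominated_pair (P : set X) (Q : set Y) :=
  [/\ closed P, closed Q, mu (Q : set (borel Y)) < +oo &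
   P = set0 \/ nu (P : set (borel X)) < mu (Q : set (borel Y))].

(** [Q] is cut along [U], the part inside [U] being replaced by a closed [Q1] so large that the two
    targets together still exceed [P]. Nonatomicity cuts [P] accordingly, and closed approximation
    of the two parts loses at most [e]. *)
Lemma split_dominated_pair (P : set X) (Q U : set Y) (e : R) :
  dominated_pair P Q -> open U -> (0 < e)%R ->
  exists P1 P0 : set X, exists Q1 : set Y,
  [/\ P1 `<=` P, P0 `<=` P, P1 `&` P0 = set0 & Q1 `<=` Q `&` U] /\
  [/\ dominated_pair P1 Q1, dominated_pair P0 (Q `\` U) &
     nu (P `\` (P1 `|` P0) : set (borel X)) <= e%:E].
Proof.
move=> [cP cQ Qoo PQ] oU e0.
have mQ : measurable (Q : set (borel Y)) by exact: closed_measurable_borel.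
have mU : measurable (U : set (borel Y)) by exact: open_measurable_borel.
have mP : measurable (P : set (borel X)) by exact: closed_measurable_borel.
have Q'oo (Q' : set Y) : measurable (Q' : set (borel Y)) -> Q' `<=` Q ->
    mu (Q' : set (borel Y)) < +oo.
  by move=> mQ' Q'Q; rewrite (le_lt_trans _ Qoo)// mu_subset.
have cQU : closed (Q `\` U) by apply: closedI => //; exact: open_closedC.
have QUoo : mu (Q `\` U : set (borel Y)) < +oo.
  by apply: Q'oo; [exact: closed_measurable_borel|move=> x []].
have d0 (Q' : set Y) : closed Q' -> Q' `<=` Q -> dominated_pair set0 Q'.
  move=> cQ' Q'Q; split => //; [exact: closed0| |by left].
  by apply: Q'oo => //; exact: closed_measurable_borel.
case: PQ => [->|PQ].
  exists set0, set0, set0; split.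
    by split; rewrite ?set0I//; exact: sub0set.
  split; [exact: d0 closed0 _|by apply: d0 => // x []|].
  by rewrite set0D measure0 lee_fin ltW.
have Poo : nu (P : set (borel X)) < +oo by rewrite (lt_trans PQ).
have mQU : measurable (Q `&` U : set (borel Y)) by exact: measurableI.
have QUoo' : mu (Q `&` U : set (borel Y)) < +oo by apply: Q'oo => // x [].
have [Q1 [cQ1 Q1QU PQ1]] : exists Q1 : set Y, [/\ closed Q1, Q1 `<=` Q `&` U &
    nu (P : set (borel X)) < mu (Q1 : set (borel Y)) + mu (Q `\` U : set (borel Y))].
  pose c := (fine (nu (P : set (borel X))) - fine (mu (Q `\` U : set (borel Y))))%R.
  have [|Q1 [cQ1 Q1QU h]] := inner_regular_lt mY cY (c := c) mQU QUoo'.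
    rewrite EFinB !fineK ?ge0_fin_numE// lteBlDr ?ge0_fin_numE//.
    by rewrite addeC -(measureDI _ mQ mU).
  exists Q1; split => //.
  by move: h; rewrite EFinB !fineK ?ge0_fin_numE// lteBlDr ?ge0_fin_numE.
have Q1Q : Q1 `<=` Q by move=> x /Q1QU[].
have mQ1 : measurable (Q1 : set (borel Y)) by exact: closed_measurable_borel.
have Q1oo := Q'oo _ mQ1 Q1Q.
have sub_pair (P' : set X) (Q' : set Y) : closed P' -> closed Q' -> Q' `<=` Q ->
    nu (P' : set (borel X)) < mu (Q' : set (borel Y)) -> dominated_pair P' Q'.
  move=> cP' cQ' Q'Q lt; split => //; last by right.
  by apply: Q'oo => //; exact: closed_measurable_borel.
(* If one target alone exceeds [P], all of [P] goes there and nothing is lost. *)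
have [Pa1|a1P] := ltP (nu (P : set (borel X))) (mu (Q1 : set (borel Y))).
  exists P, set0, Q1; split; first by split; rewrite ?setI0//; exact: sub0set.
  split; [exact: sub_pair|by apply: d0 => // x []|].
  by rewrite setU0 setDv measure0 lee_fin ltW.
have [Pa0|a0P] := ltP (nu (P : set (borel X))) (mu (Q `\` U : set (borel Y))).
  exists set0, P, Q1; split; first by split; rewrite ?set0I//; exact: sub0set.
  split; [exact: d0|by apply: sub_pair => // x []|].
  by rewrite set0U setDv measure0 lee_fin ltW.
have e2 : (0 < e / 2)%R by rewrite divr_gt0.
have fP : nu (P : set (borel X)) = (fine (nu (P : set (borel X))))%:E.
  by rewrite fineK// ge0_fin_numE.
have fQ1 : mu (Q1 : set (borel Y)) = (fine (mu (Q1 : set (borel Y))))%:E.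
  by rewrite fineK// ge0_fin_numE.
have fQU : mu (Q `\` U : set (borel Y)) = (fine (mu (Q `\` U : set (borel Y))))%:E.
  by rewrite fineK// ge0_fin_numE.
(* Since [p < a1 + a0], some [P'] has measure strictly between [p - a0] and [a1]; the rest of [P]
   then has measure below [a0]. *)
move: PQ1 a1P a0P; rewrite fP fQ1 fQU -EFinD !lte_fin !lee_fin.
set p := fine _; set a1 := fine _; set a0 := fine _ => PQ1 a1P a0P.
have [|||P' [mP' P'P sP' P'a1]] :=
  nonatomic_intermediate mX cX nu_nonatomic (s := (p - a0)%R) (c := a1) mP Poo.
- by rewrite subr_ge0.
- by rewrite ltrBlDr.
- by rewrite fP lte_fin -/p; lra.
have P'oo : nu P' < +oo by rewrite (le_lt_trans _ Poo)// mu_subset.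
have mPP' : measurable ((P : set (borel X)) `\` P') by exact: measurableD.
have PP'oo : nu ((P : set (borel X)) `\` P') < +oo.
  by rewrite (le_lt_trans _ Poo)// mu_subset// => x [].
have [P1 [cP1 P1P' l1]] := inner_regular mX cX mP' P'oo e2.
have [P0 [cP0 P0P' l0]] := inner_regular mX cX mPP' PP'oo e2.
have mP1 : measurable (P1 : set (borel X)) by exact: closed_measurable_borel.
have mP0 : measurable (P0 : set (borel X)) by exact: closed_measurable_borel.
exists P1, P0, Q1; split.
  split => //.
  - exact: subset_trans P'P.
  - by move=> x /P0P'[].
  - by rewrite -subset0 => x [/P1P' h /P0P'[]].
split.
- apply: sub_pair => //.
  by apply: le_lt_trans (mu_subset nu mP1 mP' P1P') _; rewrite fQ1.
- apply: sub_pair => //.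
  apply: le_lt_trans (mu_subset nu mP0 mPP' P0P') _; rewrite fQU -/a0.
  rewrite measureD// setIidr// [X in X - _]fP -/p lteBlDr ?ge0_fin_numE//.
  by move: sP'; rewrite EFinB lteBlDr// addeC.
- have -> : P `\` (P1 `|` P0) = (P' `\` P1) `|` ((P `\` P') `\` P0).
    apply/seteqP; split => x.
      move=> [Px] /not_orP[nP1 nP0].
      by have [Px'|nPx'] := pselect (P' x); [left|right].
    move=> [[P'x nP1]|[[Px nP'] nP0]]; split.
    + exact: P'P.
    + by move=> [//|/P0P'[]].
    + by [].
    + by move=> [/P1P'|//].
  rewrite (splitr e) EFinD.
  apply: le_trans (leeD l1 l0); apply: measureU2; exact: measurableD.
Qed.
End split_pair.

Section level.
Variable T : Type.
Implicit Types (F : seq bool -> set T) (k : nat).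

(* A node of the tree lists its branching choices, the latest one first. *)
Fixpoint level F k (s : seq bool) : set T :=
  if k is k'.+1 then level F k' (true :: s) `|` level F k' (false :: s) else F s.

Lemma level_sub F k s : (forall b s, F (b :: s) `<=` F s) -> level F k s `<=` F s.
Proof.
by move=> mF; elim: k s => [s x //|k IH s x /= [] /IH]; exact: mF.
Qed.

Lemma level_subS F k s : (forall b s, F (b :: s) `<=` F s) ->
  level F k.+1 s `<=` level F k s.
Proof.
move=> mF; elim: k s => [|k IH] s; first by move=> x /= [] /mF.
by move=> x [] /IH; [left|right].
Qed.

Lemma level_mem F k s x : level F k s x ->
  exists2 t, size t = (k + size s)%N & F t x.
Proof.
elim: k s => [|k IH] s /=; first by move=> Fs; exists s.
by move=> [] /IH[t /= st Ft]; exists t; rewrite // st addnS addSn.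
Qed.
End level.

Section transport.
Variables (R : realType) (X Y : ptopologicalType).
Variables (dX : X -> X -> R) (dY : Y -> Y -> R).
Hypotheses (mX : metrizes dX) (cX : compact [set: X]).
Hypotheses (mY : metrizes dY) (cY : compact [set: Y]).
Variables (nu : {measure set (borel X) -> \bar R}).
Variables (mu : {measure set (borel Y) -> \bar R}).
Hypothesis nu_nonatomic : nonatomic nu.

Let dominated := dominated_pair nu mu.

(** Iterated splitting, with [U n] used at depth [n]. The loss allowed at [s] is weighted by
    [pickle s], so that all losses add up to at most [e]. *)
Lemma dominated_tree (Z : set X) (L : set Y) (U : nat -> set Y) (e : R) :
  dominated Z L -> (forall n, open (U n)) -> 0 < e ->
  exists (P : seq bool -> set X) (Q : seq bool -> set Y),
  [/\ P [::] = Z, Q [::] = L & forall s, dominated (P s) (Q s)] /\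
  forall s, [/\ forall b, P (b :: s) `<=` P s, forall b, Q (b :: s) `<=` Q s,
    P (true :: s) `&` P (false :: s) = set0,
    Q (true :: s) `<=` U (size s) /\ Q (false :: s) `&` U (size s) = set0 &
    (nu (P s `\` (P (true :: s) `|` P (false :: s)) : set (borel X)) <=
      (e / (2 ^ (pickle s).+1)%:R)%:E)%E].
Proof.
move=> ZL oU e0.
pose spec (t : (set X * set Y) * seq bool) (r : (set X * set X) * set Y) :=
  dominated t.1.1 t.1.2 ->
  [/\ r.1.1 `<=` t.1.1, r.1.2 `<=` t.1.1, r.1.1 `&` r.1.2 = set0 &
      r.2 `<=` t.1.2 `&` U (size t.2)] /\
  [/\ dominated r.1.1 r.2, dominated r.1.2 (t.1.2 `\` U (size t.2)) &
     (nu (t.1.1 `\` (r.1.1 `|` r.1.2) : set (borel X)) <=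
       (e / (2 ^ (pickle t.2).+1)%:R)%:E)%E].
have /choice[r hr] t : exists r, spec t r.
  have [tPQ|ntPQ] := pselect (dominated t.1.1 t.1.2); last first.
    by exists (set0, set0, set0) => /ntPQ.
  have e2 : 0 < e / (2 ^ (pickle t.2).+1)%:R by rewrite divr_gt0// ltr0n expn_gt0.
  have [P1 [P0 [Q1 h]]] := split_dominated_pair mX cX mY cY nu_nonatomic tPQ (oU (size t.2)) e2.
  by exists (P1, P0, Q1).
pose fix tree s : set X * set Y := if s is b :: s' then
    let t := tree s' in
    if b then ((r (t, s')).1.1, (r (t, s')).2)
    else ((r (t, s')).1.2, t.2 `\` U (size s'))
  else (Z, L).
exists (fun s => (tree s).1), (fun s => (tree s).2).
have dom s : dominated (tree s).1 (tree s).2.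
  by elim: s => [//|[] s IH] /=; have [_ []] := hr (tree s, s) IH.
split=> // s; have [[/= h1 h2 h3 h4] [_ _ h5]] := hr (tree s, s) (dom s); split => //.
- by case.
- by case=> [x /h4[]|x []].
- split; first by move=> x /h4[].
  by rewrite -subset0 => x [[_]].
Qed.

(* [l i] is taken in the [i]-th generation piece of [L] matched with the piece
   of [Z] that contains an almost nearest point to [p i]. Then [K] meets all
   pieces of [L] matched with the pieces around a cluster point [z]. *)
Lemma transport (Z : set X) (L : set Y) (e : R) (p : nat -> X) :
  closed Z -> closed L ->
  (nu (Z : set (borel X)) < mu (L : set (borel Y)))%E ->
  (mu (L : set (borel Y)) < +oo)%E -> 0 < e ->
  exists l : nat -> Y, (forall i, L (l i)) /\
  forall K : set Y, closed K -> exists W : set (borel X),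
  [/\ measurable W, (nu W <= mu (K `&` L : set (borel Y)) + e%:E)%E &
    forall z, Z z -> (forall c m, 0 < c -> exists i, [/\ (m <= i)%N, dX z (p i) < c &
      exists2 y, K y & dY (l i) y <= i.+1%:R^-1]) -> W z].
Proof.
move=> cZ cL ZL Loo e0; have ZLd : dominated Z L by split => //; right.
have [U [oU hU]] := countable_base_exists mY cY.
have [P [Q [[P0 Q0 dom] PQ]]] := dominated_tree ZLd oU e0.
have cP s : closed (P s) by case: (dom s).
have cQ s : closed (Q s) by case: (dom s).
have mP s : measurable (P s : set (borel X)) by exact: closed_measurable_borel.
have mQ s : measurable (Q s : set (borel Y)) by exact: closed_measurable_borel.
have PS b s : P (b :: s) `<=` P s by case: (PQ s).
have QS b s : Q (b :: s) `<=` Q s by case: (PQ s).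
have QL s : Q s `<=` L.
  rewrite -Q0; elim: s => [//|b s IH]; exact: subset_trans (QS b s) IH.
have dis s : P (true :: s) `&` P (false :: s) = set0 by case: (PQ s).
have Qn0 s x : P s x -> Q s !=set0.
  move=> Px; have [_ _ _ [Ps0|lt]] := dom s; first by rewrite Ps0 in Px.
  by apply/set0P/eqP => Qs0; move: lt; rewrite Qs0 measure0 ltNge measure_ge0.
(* The address of [z] at depth [k]. A point outside both children is sent to [false]; [Z'] keeps the
   points of [Z] for which this never happens. *)
pose fix branch k z {struct k} : seq bool := if k is k'.+1
  then `[< P (true :: branch k' z) z >] :: branch k' z else [::].
pose Z' := [set z | forall k, P (branch k z) z].
have branch_sub k i z : Q (branch (k + i)%N z) `<=` Q (branch k z).
  elim: i => [|i IH]; first by rewrite addn0.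
  by rewrite addnS; exact: subset_trans (QS _ _) IH.
(* Sibling pieces are closed and disjoint, so near [z] one of them is missed, which decides the next
   choice of all points of [Z'] there. *)
have branch_cont z k : exists2 c, 0 < c & forall w, Z' w -> dX z w < c ->
    branch k w = branch k z.
  elim: k => [|k [c c0 IH]]; first by exists 1.
  have far b : ~ P (b :: branch k z) z -> exists2 c, 0 < c &
      forall w, dX z w < c -> ~ P (b :: branch k z) w.
    by have /(open_distP mX) := closed_openC (cP (b :: branch k z)); exact.
  have [Pz|Pz] := pselect (P (true :: branch k z) z).
    have [|c' c'0 hc'] := far false.
      move=> Pz'; suff : set0 z by [].
      by rewrite -(dis (branch k z)).
    exists (Num.min c c'); first by rewrite lt_min c0.
    move=> w Zw; rewrite lt_min => /andP[/(IH _ Zw) E /hc' nPw].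
    have := Zw k.+1; rewrite /= E (asboolT Pz).
    by case: asboolP.
  have [c' c'0 hc'] := far _ Pz.
  exists (Num.min c c'); first by rewrite lt_min c0.
  move=> w Zw; rewrite lt_min => /andP[/(IH _ Zw) E /hc' nPw].
  by rewrite /= E (asboolF Pz) (asboolF nPw).
(* A point of [Z'] nearest to [p i] up to [1/(i+1)], with a point of the piece of [L] matched to its
   address of depth [i]. If [Z'] is empty, any point of [L] serves. *)
have /choice[wl hwl] (i : nat) : exists wl : X * Y, L wl.2 /\ (Z' !=set0 ->
    [/\ Z' wl.1, Q (branch i wl.1) wl.2 &
     forall z, Z' z -> dX wl.1 (p i) <= dX z (p i) + i.+1%:R^-1]).
  have [[z0 Z'z0]|nZ'] := pselect (Z' !=set0); last first.
    suff [l Ll] : L !=set0 by exists (point, l).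
    apply/set0P/eqP => L0; move: ZL; rewrite L0 measure0 ltNge measure_ge0 //.
  pose D := [set dX z (p i) | z in Z'].
  have infD : has_inf D.
    split; first by exists (dX z0 (p i)), z0.
    by exists 0 => _ [z _ <-]; exact: dist_ge0.
  have [_ [w Z'w <-] wi] := @inf_adherent _ D i.+1%:R^-1 ltac:(by []) infD.
  have [l Ql] := Qn0 _ _ (Z'w i).
  exists (w, l); split; first exact: QL Ql.
  split => //= z Z'z; rewrite (le_trans (ltW wi))// lerD2r.
  by apply: ge_inf; [exact: infD.2|exists z].
exists (fun i => (wl i).2); split=> [i|K cK]; first by case: (hwl i).
have mK : measurable (K : set (borel Y)) by exact: closed_measurable_borel.
(* Only pieces whose part of [L] meets [K] count; [FP] and [FQ] replace the others by the empty
   set. *)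
pose hit s := K `&` Q s !=set0.
pose FP s := [set x | P s x /\ hit s].
pose FQ s := [set y | Q s y /\ hit s].
have hitS b s : hit (b :: s) -> hit s by move=> [y [Ky /QS]]; exists y.
have FPS b s : FP (b :: s) `<=` FP s by move=> x [/PS ? /hitS].
have FQS b s : FQ (b :: s) `<=` FQ s by move=> x [/QS ? /hitS].
have mFP s : measurable (FP s : set (borel X)).
  have [h|h] := pselect (hit s); first by rewrite (_ : FP s = P s)//; apply/seteqP; split=> x // [].
  by rewrite (_ : FP s = set0)// -subset0 => x [].
have mFQ s : measurable (FQ s : set (borel Y)).
  have [h|h] := pselect (hit s); first by rewrite (_ : FQ s = Q s)//; apply/seteqP; split=> x // [].
  by rewrite (_ : FQ s = set0)// -subset0 => x [].
have mlP k s : measurable (level FP k s : set (borel X)).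
  by elim: k s => [//|k IH] s /=; exact: measurableU.
have mlQ k s : measurable (level FQ k s : set (borel Y)).
  by elim: k s => [//|k IH] s /=; exact: measurableU.
have le_level k s : (nu (level FP k s : set (borel X)) <= mu (level FQ k s : set (borel Y)))%E.
  elim: k s => [|k IH] s /=.
    have [h|h] := pselect (hit s).
      rewrite (_ : FP s = P s); last by apply/seteqP; split=> x // [].
      rewrite (_ : FQ s = Q s); last by apply/seteqP; split=> x // [].
      have [_ _ _ [->|/ltW//]] := dom s.
      by rewrite measure0 measure_ge0.
    rewrite (_ : FP s = set0); last by rewrite -subset0 => x [].
    by rewrite measure0 measure_ge0.
  rewrite (@measureU _ _ _ mu)//; last first.
    rewrite -subset0 => y [/(level_sub FQS)[Qt _] /(level_sub FQS)[Qf _]].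
    have [_ _ _ [/(_ _ Qt) Uy Q'U] _] := PQ s.
    by rewrite -Q'U.
  by apply: le_trans (leeD (IH _) (IH _)); exact: measureU2.
pose loss s : set (borel X) := P s `\` (P (true :: s) `|` P (false :: s)).
have mloss s : measurable (loss s) by apply: measurableD => //; exact: measurableU.
pose lossn n := if @pickle_inv (seq bool) n is Some s then loss s else set0.
have mlossn n : measurable (lossn n) by rewrite /lossn; case: pickle_inv.
(* [W] collects the points that lie in hit pieces at all depths and everything the splittings lose,
   of measure at most [e]. *)
exists (\bigcap_k level FP k [::] `|` \bigcup_n lossn n); split.
- by apply: measurableU; [exact: bigcapT_measurable|exact: bigcupT_measurable].
- apply: le_trans (measureU2 _ _ _) _.
  + exact: bigcapT_measurable.
  + exact: bigcupT_measurable.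
  apply: leeD; last first.
    apply: le_trans (epsilon_trick0 xpredT (ltW e0)).
    apply: le_trans (measure_sigma_subadditive _ _
      (bigcupT_measurable _ mlossn) (@subset_refl _ _)) _ => //.
    apply: lee_nneseries => // n _; rewrite /lossn.
    have := @pickle_invK (seq bool) n; case: pickle_inv => [s /= <-|_].
      by case: (PQ s).
    by rewrite measure0 lee_fin divr_ge0// ltW.
  apply: (@le_trans _ _ (mu (\bigcap_k level FQ k [::] : set (borel Y)))).
    rewrite leNgt; apply/negP => /mu_bigcap_lt[|//||k].
    + by rewrite (le_lt_trans _ Loo)// mu_subset// => [|y [/QL]//]; exact: closed_measurable_borel.
    + by apply/nonincreasing_seqP => k; apply/subsetPset; exact: level_subS.
    rewrite ltNge => /negP; apply; apply: le_trans (le_level k [::]).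
    by apply: mu_subset => //; [exact: bigcapT_measurable|exact: bigcap_inf].
  apply: mu_subset.
  + exact: bigcapT_measurable.
  + by apply: measurableI => //; exact: closed_measurable_borel.
  move=> y ly; split; last by have [/QL] := ly 0%N I.
  (* A basic [U k] around [y] has closure disjoint from [K]. The splitting at depth [k] puts [y] in
     a piece inside [U k], which cannot be hit. *)
  apply: contrapT => nKy.
  have [k Uy UK] := hU _ y (closed_openC cK) nKy.
  have [[//|b s] [sk] [Qy [x [Kx Qx]]]] := level_mem (ly k.+1 I).
  have [_ _ _ [Q1U Q0U] _] := PQ s; move: sk; rewrite addn0 => sk.
  case: b Qy Qx => Qy Qx.
    by have /Q1U := Qx; rewrite sk => /subset_closure /UK.
  suff : (Q (false :: s) `&` U (size s)) y by rewrite Q0U.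
  by split => //; rewrite sk.
(* Either the address of [z] first fails at some depth and [z] is lost in the splitting before it,
   or [z] is in [Z'] and all pieces on its path are hit. *)
move=> z Zz hz; have [Z'z|] := pselect (Z' z); last first.
  move=> /existsNP nZ'; right; have ex : exists k, `[< ~ P (branch k z) z >].
    by have [k ?] := nZ'; exists k; apply/asboolP.
  case: (ex_minnP ex) => -[|k] /asboolP nP mink; first by move: nP; rewrite /= P0.
  exists (pickle (branch k z)) => //; rewrite /lossn pickleK_inv; split.
    apply: contrapT => nPk; have := mink k; rewrite ltnn => h.
    by apply/notF/h/asboolP.
  move: nP => /=; case: asboolP => // nP1 nP0 [] //.
left => k _.
have hitz j : hit (branch j z).
  apply: (closed_meets_of_dist mY cY cK (cQ _)) => c c0.
  have [c' c'0 hc'] := branch_cont z j.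
  (* The point of [Z'] chosen for [p i] is within twice [dX z (p i)] plus [1/(i+1)] of [z], hence
     within [3c'/4]. *)
  have c4 : 0 < c' / 4 by rewrite divr_gt0.
  have [m1 hm1] := invS_small c0; have [m2 hm2] := invS_small c4.
  have [i [mi zpi [y Ky ly]]] := hz (c' / 4) (maxn j (maxn m1 m2)) c4.
  move: mi; rewrite !geq_max => /and3P[ji m1i m2i].
  have [_ /(_ (ex_intro _ z Z'z))[Z'w Qw wnear]] := hwl i.
  exists y, (wl i).2; split => //; last first.
    by rewrite (dist_sym mY) (le_lt_trans ly)// hm1.
  rewrite -(hc' _ Z'w).
    by move: Qw; rewrite -(subnKC ji) => /branch_sub.
  rewrite (le_lt_trans (dist_triangle mX _ (p i) _))// (dist_sym mX (p i)).
  have := wnear _ Z'z.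
  by have := hm2 _ m2i; move: zpi; set a := dX z _; set b := i.+1%:R^-1; lra.
suff lev j i : FP (branch (i + j)%N z) z -> level FP j (branch i z) z.
  by apply: (lev k 0%N); split; [exact: Z'z|exact: hitz].
elim: j i => [|j IH] i /=; first by rewrite addn0.
rewrite addnS -addSn => /IH /=; case: asboolP => _; by [left|right].
Qed.
End transport.

(** * Cells *)

Section sigma_closed_finite.
Variables (R : realType) (Y : ptopologicalType) (d : Y -> Y -> R).
Hypotheses (dY : metrizes d) (cY : compact [set: Y]).
Variable mu : {measure set (borel Y) -> \bar R}.

(* [Jf] without its measurability clause. *)
Definition Jcover (A : set Y) := exists K : nat -> set Y,
  (forall n, closed (K n) /\ (mu (K n : set (borel Y)) < +oo)%E) /\
  A `<=` \bigcup_n K n.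

Lemma JcoverS (A B : set Y) : A `<=` B -> Jcover B -> Jcover A.
Proof. by move=> AB [K [hK BK]]; exists K; split => //; exact: subset_trans BK. Qed.

Lemma Jcover_bigcup (A : nat -> set Y) : (forall n, Jcover (A n)) ->
  Jcover (\bigcup_n A n).
Proof.
move=> /choice[K hK].
exists (fun m => if @unpickle (nat * nat)%type m is Some (i, j) then K i j else set0).
split=> [m|y [i _ /(proj2 (hK i))[j _ Ky]]].
  case: unpickle => [[i j]|]; first exact: (hK i).1.
  by split; [exact: closed0|rewrite measure0].
by exists (pickle (i, j)) => //; rewrite pickleK.
Qed.

Lemma JcoverU (A B : set Y) : Jcover A -> Jcover B -> Jcover (A `|` B).
Proof.
move=> JA JB; rewrite (_ : A `|` B = \bigcup_n (if n is 0%N then A else B)).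
  by apply: Jcover_bigcup => -[].
apply/seteqP; split => [x [Ax|Bx]|x [[|n] _ ?]]; [|exists 1%N|left|right] => //.
by exists 0%N.
Qed.

Lemma Jcover_closed (A : set Y) : closed A -> (mu (A : set (borel Y)) < +oo)%E ->
  Jcover A.
Proof. by move=> cA Aoo; exists (fun=> A); split => // x; exists 0%N. Qed.

Lemma Jcover0 : Jcover set0.
Proof. by apply: Jcover_closed; [exact: closed0|rewrite measure0]. Qed.

Lemma JfE (A : set (borel Y)) : Jf mu A <-> measurable A /\ Jcover A.
Proof.
split=> -[mA [K [hK AK]]]; split => //; exists K; split => // n; have [cK ?] := hK n.
  by split => //; apply: compact_closed cK; exact: hausdorff_dist dY.
by split => //; exact: subclosed_compact cK cY _.
Qed.

(** As in the Cantor-Bendixson theorem: delete from [D] the basic open sets where it is locally in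
    the ideal. What remains is outside the ideal, so its closure [H] has infinite measure. *)
Lemma not_Jcover_kernel (D : set Y) : ~ Jcover D ->
  exists H : set Y, [/\ closed H, mu (H : set (borel Y)) = +oo%E, H `<=` closure D &
    forall V y, open V -> H y -> V y -> ~ Jcover (D `&` V)].
Proof.
move=> nD; have [U [oU hU]] := countable_base_exists dY cY.
pose V k := if pselect (Jcover (D `&` U k)) then U k else set0.
pose D' := D `\` \bigcup_k V k.
have nD' : ~ Jcover D'.
  move=> JD'; apply: nD; apply: (@JcoverS _ (D' `|` \bigcup_k (D `&` V k))).
    move=> x Dx; have [Vx|Vx] := pselect ((\bigcup_k V k) x); last by left.
    by right; have [k _ Vk] := Vx; exists k.
  apply: JcoverU => //; apply: Jcover_bigcup => k; rewrite /V.
  by case: pselect => //= _; rewrite setI0; exact: Jcover0.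
exists (closure D'); split; first exact: closed_closure.
- apply/eqP; rewrite -leye_eq leNgt; apply/negP => D'oo; apply: nD'.
  by apply: (JcoverS _ (Jcover_closed (@closed_closure _ _) D'oo)); exact: subset_closure.
- by apply: closure_subset => x [].
move=> W y oW D'y Wy JDW; have [k Uy UW] := hU _ _ oW Wy.
have [x [[Dx nVx] Ux]] := D'y _ (open_nbhs_nbhs (conj (oU k) Uy)).
apply: nVx; exists k => //; rewrite /V; case: pselect => //= nJ; case: nJ.
by apply: (JcoverS _ JDW) => t [Dt /subset_closure /UW].
Qed.

End sigma_closed_finite.

Definition souslin_part (Y : Type) (F : seq nat -> set Y) (s : seq nat) : set Y :=
  [set y | exists a : nat -> nat, mkseq a (size s) = s /\ forall n, F (mkseq a n) y].

Lemma souslin_part_rcons Y (F : seq nat -> set Y) s :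
  souslin_part F s `<=` \bigcup_k souslin_part F (rcons s k).
Proof.
move=> y [a [as_ Fy]]; exists (a (size s)) => //; exists a; split => //.
by rewrite size_rcons mkseqS as_.
Qed.

(** * One node of the tree of cells and its children *)

Section node.
Variables (R : realType) (X Y : ptopologicalType).
Variables (dX : X -> X -> R) (dY : Y -> Y -> R).
Hypotheses (mX : metrizes dX) (cX : compact [set: X]).
Hypotheses (mY : metrizes dY) (cY : compact [set: Y]).
Variables (nu : {measure set (borel X) -> \bar R}).
Variables (mu : {measure set (borel Y) -> \bar R}).
Hypotheses (nu_nonatomic : nonatomic nu) (mu_nonatomic : nonatomic mu).
Variable F : seq nat -> set Y.

(** A closed cell is stored with a Souslin prefix; the piece of [B] it carries is the part of the
    Souslin set along that prefix within the cell. *)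
Definition big_cell (q : seq nat * set Y) :=
  closed q.2 /\ ~ Jcover mu (souslin_part F q.1 `&` q.2).

Lemma big_cell_root (B : set Y) : souslin F B -> ~ Jcover mu B ->
  big_cell ([::], setT).
Proof.
move=> [_ FB] nB; split; first exact: closedT.
rewrite /= setIT; apply: contra_not nB; apply: JcoverS => y.
by move=> /FB[a Fa]; exists a.
Qed.

(** [V] without [L] is F-sigma and the prefix has countably many extensions. As [L] is in the
    sigma-ideal, one extension with one closed part is outside it. *)
Lemma big_cell_shrink (q : seq nat * set Y) (L V : set Y) :
  closed q.2 -> closed L -> (mu (L : set (borel Y)) < +oo)%E -> open V ->
  ~ Jcover mu (souslin_part F q.1 `&` q.2 `&` V) ->
  exists q' : seq nat * set Y,
    [/\ big_cell q', exists k, q'.1 = rcons q.1 k & q'.2 `<=` q.2 `&` V `\` L].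
Proof.
case: q => t C /= cC cL Loo oV nJ.
have [E cE VLE] : exists2 E : nat -> set Y, (forall n, closed (E n)) & V `\` L = \bigcup_n E n.
  by apply: (open_Fsigma mY cY); apply: openI => //; exact: closed_openC.
have [k [n nkn]] : exists k n, ~ Jcover mu (souslin_part F (rcons t k) `&` (C `&` E n)).
  apply: contrapT => h; apply: nJ.
  apply: (@JcoverS _ _ _ _ (L `|`
    \bigcup_k \bigcup_n (souslin_part F (rcons t k) `&` (C `&` E n)))).
    move=> y [[/(@souslin_part_rcons _ F t)[k _ sy] Cy] Vy].
    have [Ly|nLy] := pselect (L y); [by left|right].
    have : (V `\` L) y by [].
    by rewrite VLE => -[n _ Ey]; exists k => //; exists n.
  apply: JcoverU; first exact: Jcover_closed.
  apply: Jcover_bigcup => k; apply: Jcover_bigcup => n; apply: contrapT => nJ'.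
  by apply: h; exists k, n.
exists (rcons t k, C `&` E n); split => /=.
- by split => //=; exact: closedI.
- by exists k.
- move=> y [Cy Ey]; have [Vy nLy] : (V `\` L) y by rewrite VLE; exists n.
  by [].
Qed.

(** [L] is the compact set of the node [q], [ch] its children, [r] a bound on their diameters. The
    last clause is that of [transport], with hitting the child [i] in place of being close to
    [l i]. *)
Definition node_spec (Z : set X) (p : nat -> X) (e r : R) (q : seq nat * set Y)
    (L : set Y) (ch : nat -> seq nat * set Y) :=
  [/\ closed L /\ L `<=` q.2,
   forall i, [/\ big_cell (ch i), exists k, (ch i).1 = rcons q.1 k,
     (ch i).2 `<=` q.2 `\` L & forall x y, (ch i).2 x -> (ch i).2 y -> dY x y <= r],
   forall i j, i != j -> (ch i).2 `&` (ch j).2 = set0 &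
   forall K : set Y, closed K -> exists W : set (borel X),
   [/\ measurable W, (nu W <= mu (K `&` L : set (borel Y)) + e%:E)%E &
     forall z, Z z -> (forall c m, 0 < c -> exists i,
       [/\ (m <= i)%N, dX z (p i) < c & K `&` (ch i).2 !=set0]) -> W z]].

(** [L] is taken inside the kernel [H], so the cell is big near each point [l i] that [transport]
    supplies; the child [i] is found there, off [L]. *)
Lemma node_exists (Z : set X) (p : nat -> X) (e r : R) (q : seq nat * set Y) :
  closed Z -> (nu (Z : set (borel X)) < +oo)%E -> 0 < e -> 0 < r -> big_cell q ->
  exists Lch, node_spec Z p e r q Lch.1 Lch.2.
Proof.
case: q => t C cZ Zoo e0 r0 [/= cC nD].
have [H [cH Hoo HD nH]] := not_Jcover_kernel mY cY nD.
have HC : H `<=` C.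
  by move=> y /HD Dy; apply: cC; apply: closure_subset Dy => z [].
have [L [cL LH ZL Loo]] :=
  nonatomic_semifinite_closed mY cY (fine (nu (Z : set (borel X)))) mu_nonatomic cH Hoo.
rewrite fineK ?ge0_fin_numE// in ZL.
have [l [lL hl]] := transport mX cX mY cY nu_nonatomic p cZ cL ZL Loo e0.
(* [1/(i+1)] is the tolerance of [transport]; [r / 2] bounds the diameter by [r]. *)
pose rho i := Num.min i.+1%:R^-1 (r / 2).
have rho0 i : 0 < rho i by rewrite lt_min divr_gt0// andbT invr_gt0 ltr0n.
have /choice[g hg] (iA : nat * set Y) : exists q' : seq nat * set Y,
    closed iA.2 -> iA.2 `&` L = set0 ->
    [/\ big_cell q', exists k, q'.1 = rcons t k,
     q'.2 `<=` C `\` L, q'.2 `&` iA.2 = set0 & forall y, q'.2 y -> dY (l iA.1) y < rho iA.1].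
  case: iA => i A /=.
  have [[cA AL]|nA] := pselect (closed A /\ A `&` L = set0); last first.
    by exists ([::], set0) => cA AL; case: nA.
  pose V := [set y | dY (l i) y < rho i] `&` ~` A.
  have oV : open V by apply: openI; [exact: open_distball|exact: closed_openC].
  have Vl : V (l i).
    split; first by rewrite /= (dist_xx mY).
    by move=> Al; have : (A `&` L) (l i) by []; rewrite AL.
  have nJ := nH _ _ oV (LH _ (lL i)) Vl.
  have [q' [gq' kq' q'V]] := @big_cell_shrink (t, C) L V cC cL Loo oV nJ.
  exists q' => _ _; split => //.
  - by move=> y /q'V[[Cy _]].
  - by rewrite -subset0 => y [/q'V[[_ [_ nAy]] _]].
  - by move=> y /q'V[[_ []]].
(* The union of the earlier children. It is closed and misses [L], so [l i] has a neighbourhood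
   disjoint from it. *)
pose fix A i := if i is i'.+1 then A i' `|` (g (i', A i')).2 else set0.
have hA i : closed (A i) /\ A i `&` L = set0.
  elim: i => [|i [cA AL]] /=; first by rewrite set0I; split => //; exact: closed0.
  have [[cg _] _ gL _ _] := hg (i, A i) cA AL.
  split; first exact: closedU.
  by rewrite setIUl AL set0U -subset0 => y [/gL[]].
pose ch i := g (i, A i).
have hch i : [/\ big_cell (ch i), exists k, (ch i).1 = rcons t k,
    (ch i).2 `<=` C `\` L, (ch i).2 `&` A i = set0
    & forall y, (ch i).2 y -> dY (l i) y < rho i] by have [? ?] := hA i; exact: (hg (i, A i)).
have chA i j : (i < j)%N -> (ch i).2 `<=` A j.
  elim: j => [//|j IH]; rewrite ltnS leq_eqVlt => /predU1P[->|/IH h] y; [by right|].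
  by left; exact: h.
have chdis i j : (i < j)%N -> (ch i).2 `&` (ch j).2 = set0.
  move=> ij; rewrite -subset0 => y [/(chA _ _ ij) Ay cy].
  by have [_ _ _ <- _] := hch j; split.
exists (L, ch); split => /=.
- by split => //; exact: subset_trans HC.
- move=> i; have [g1 g2 g3 _ g5] := hch i; split => // x y /g5 lx /g5 ly.
  rewrite (le_trans (dist_triangle mY _ (l i) _))// (splitr r) lerD//.
    by rewrite (dist_sym mY) ltW// (lt_le_trans lx)// ge_min lexx orbT.
  by rewrite ltW// (lt_le_trans ly)// ge_min lexx orbT.
- move=> i j; rewrite neq_ltn => /orP[/chdis//|/chdis]; by rewrite setIC.
move=> K cK; have [W [mW Wle hW]] := hl _ cK; exists W; split => // z Zz hz.
apply: hW => // c m c0; have [i [mi zi [y [Ky cy]]]] := hz c m c0.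
exists i; split => //; exists y => //; have [_ _ _ _ /(_ _ cy) ly] := hch i.
by rewrite ltW// (lt_le_trans ly)// ge_min lexx.
Qed.

End node.

Lemma bigcup_countType_measurable d (T : sigmaRingType d) (I : countType)
    (D : set I) (F : I -> set T) :
  (forall i, measurable (F i)) -> measurable (\bigcup_(i in D) F i).
Proof.
move=> mF; rewrite (_ : \bigcup_(i in D) F i = \bigcup_n
    (if @pickle_inv I n is Some i then if `[< D i >] then F i else set0 else set0)).
  by apply: bigcupT_measurable => n; case: pickle_inv => // i; case: ifP.
apply/seteqP; split => [x [i Di Fx]|x [n _]].
  by exists (pickle i) => //; rewrite pickleK_inv asboolT.
by case: pickle_inv => // i; case: asboolP => // Di Fx; exists i.
Qed.

(** * Whitney covers and closed sets of finite measure in [X] *)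

Section domain.
Variables (R : realType) (X : ptopologicalType) (d : X -> X -> R).
Hypotheses (dX : metrizes d) (cX : compact [set: X]).

(* The [U i] are balls around [p i] which are small compared to the distance
   from [p i] to [E]. *)
Lemma whitney_cover (E : set X) : closed E -> exists (p : nat -> X) (U : nat -> set X),
  [/\ forall i, open (U i), forall x, ~ E x -> exists i, U i x,
    forall i, closure (U i) `&` E = set0 &
    forall i z w, E z -> U i w -> d z (p i) <= 2 * d z w].
Proof.
move=> cE; have [q hq] := dense_seq_exists dX cX.
pose p m := if @unpickle (nat * nat)%type m is Some (j, _) then q j else point.
pose U m := if @unpickle (nat * nat)%type m is Some (j, k) then
  if `[< forall e, E e -> 2 * k.+1%:R^-1 <= d (q j) e >]
  then [set y | d (q j) y < k.+1%:R^-1] else set0 else set0.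
have hU m w : U m w -> exists r, d (p m) w < r /\ forall e, E e -> 2 * r <= d (p m) e.
  rewrite /U /p; case: unpickle => [[j k]|//]; case: asboolP => // h /= ?.
  by exists k.+1%:R^-1.
exists p, U; split.
- move=> m; rewrite /U; case: unpickle => [[j k]|]; last exact: open0.
  by case: asboolP => _; [exact: open_distball|exact: open0].
- move=> x nEx; have /(open_distP dX) oE := closed_openC cE.
  have [c c0 hc] := oE _ nEx.
  (* A centre within [c / 4] of [x] is at distance at least [3c/4] from [E], more than twice a
     radius below [c / 4]. *)
  have c4 : 0 < c / 4 by rewrite divr_gt0.
  have [k /(_ _ (leqnn k)) hk] := invS_small c4.
  have [j hj] := hq x k.+1%:R^-1 ltac:(by []).
  exists (pickle (j, k)); rewrite /U pickleK asboolT//= => e Ee.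
  have : c <= d x e by rewrite leNgt; apply/negP => /hc.
  have := dist_triangle dX x (q j) e; rewrite (dist_sym dX x (q j)).
  by move: hk hj; set a := k.+1%:R^-1; lra.
- move=> m; rewrite -subset0 => z [Uz Ez].
  have : exists2 r, 0 < r & forall w, U m w -> r <= d z w.
    rewrite /U; case E1 : unpickle => [[j k]|]; last by exists 1.
    case: asboolP => h; last by exists 1.
    exists k.+1%:R^-1 => // w /= qw; have := h _ Ez.
    have := dist_triangle dX (q j) w z; rewrite (dist_sym dX w z).
    by move: qw; set a := k.+1%:R^-1; lra.
  move=> [r r0 hr]; have /(closure_distP dX) := Uz.
  by move=> /(_ _ r0)[w /hr]; rewrite leNgt => /negP.
move=> m z w Ez /hU[r [pw /(_ _ Ez)]].
have := dist_triangle dX (p m) w z; have := dist_triangle dX z w (p m).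
rewrite (dist_sym dX w z) (dist_sym dX (p m) z) (dist_sym dX w (p m)).
by move: pw; lra.
Qed.

Variable nu : {measure set (borel X) -> \bar R}.

(** Closed approximations of each [A i] with errors [1/(j+1)] exhaust it up to a null set. *)
Lemma sigma_finite_closed : sigma_finite [set: borel X] nu ->
  exists E : nat -> set X,
  (forall n, closed (E n) /\ (nu (E n : set (borel X)) < +oo)%E) /\
  nu (~` (\bigcup_n E n) : set (borel X)) = 0%E.
Proof.
move=> [A AT hA].
have /choice[F hF] (n : nat * nat) : exists F : set X, [/\ closed F, F `<=` A n.1 &
    (nu (A n.1 `\` F) <= n.2.+1%:R^-1%:E)%E].
  by have [mA Aoo] := hA n.1; apply: (inner_regular dX cX mA Aoo).
pose E m := if @unpickle (nat * nat)%type m is Some n then F n else set0.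
have mF n : measurable (F n : set (borel X)).
  by apply: closed_measurable_borel; case: (hF n).
have cE n : closed (E n).
  by rewrite /E; case: unpickle => [m|]; [case: (hF m)|exact: closed0].
have mE n : measurable (E n : set (borel X)) by exact: closed_measurable_borel.
exists E; split.
  move=> n; split => //; rewrite /E; case: unpickle => [m|]; last by rewrite measure0.
  have [_ Foo] := hA m.1; rewrite (le_lt_trans _ Foo)// mu_subset//.
    by case: (hA m.1).
  by case: (hF m).
have mA i : measurable (A i `\` \bigcup_j F (i, j)).
  apply: measurableD; first by case: (hA i).
  exact: bigcupT_measurable.
apply/eqP; rewrite -measure_le0.
apply: (@le_trans _ _ (\sum_(i <oo) nu (A i `\` \bigcup_j F (i, j)))%E).
  apply: measure_sigma_subadditive => //.
    by apply: measurableC; exact: bigcupT_measurable.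
  move=> x nEx; have : [set: borel X] x by [].
  rewrite AT => -[i _ Ax]; exists i => //; split => // -[j _ Fx]; apply: nEx.
  by exists (pickle (i, j)) => //; rewrite /E pickleK.
rewrite eseries0// => i _ _; apply/eqP; rewrite -measure_le0.
apply/lee_addgt0Pr => e e0; rewrite add0e.
have [j /(_ _ (leqnn j)) je] := invS_small e0.
apply: (@le_trans _ _ (nu (A i `\` F (i, j)))).
  apply: mu_subset => //; first by apply: measurableD => //; case: (hA i).
  by move=> x [Ax nFx]; split => // Fx; apply: nFx; exists j.
have [_ _ /= h] := hF (i, j); apply: (le_trans h).
by rewrite lee_fin ltW.
Qed.

End domain.

(** * The tree of cells *)

Section cell_tree.
Variables (R : realType) (X Y : ptopologicalType).
Variables (dX : X -> X -> R) (dY : Y -> Y -> R).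
Hypotheses (mX : metrizes dX) (cX : compact [set: X]).
Hypotheses (mY : metrizes dY) (cY : compact [set: Y]).
Variables (nu : {measure set (borel X) -> \bar R}).
Variables (mu : {measure set (borel Y) -> \bar R}).
Variables (F : seq nat -> set Y) (B : set Y).
Hypothesis sFB : souslin F B.
Variables (E : nat -> set X) (p : nat -> nat -> X) (U : nat -> nat -> set X).
Hypotheses (cE : forall n, closed (E n))
  (E0 : nu (~` (\bigcup_n E n) : set (borel X)) = 0%E).
Hypotheses (oU : forall n i, open (U n i))
  (EU : forall n x, ~ E n x -> exists i, U n i x)
  (clUE : forall n i, closure (U n i) `&` E n = set0)
  (pU : forall n i z w, E n z -> U n i w -> dX z (p n i) <= 2 * dX z w).

Variables (q : seq nat -> seq nat * set Y) (L : seq nat -> set Y).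
Hypotheses (q0 : q [::] = ([::], setT))
  (hq : forall s, node_spec dX dY nu mu F (E (size s)) (p (size s))
    (1 / (2 ^ (pickle s).+1)%:R) (size s).+1%:R^-1 (q s) (L s) (fun i => q (i :: s))).
Hypothesis nB : ~ Jcover mu B.

Let C s := (q s).2.

Let q_big s : big_cell mu F (q s).
Proof.
elim: s => [|i s _]; last by have [_ /(_ i)[]] := hq s.
by rewrite q0; exact: big_cell_root sFB nB.
Qed.

Let closed_C s : closed (C s). Proof. by case: (q_big s). Qed.
Let closed_L s : closed (L s). Proof. by have [[]] := hq s. Qed.
Let L_C s : L s `<=` C s. Proof. by have [[]] := hq s. Qed.
Let C_subD i s : C (i :: s) `<=` C s `\` L s.
Proof. by have [_ /(_ i)[]] := hq s. Qed.
Let C_sub i s : C (i :: s) `<=` C s.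
Proof. by move=> y /C_subD[]. Qed.
Let C_diam i s x y : C (i :: s) x -> C (i :: s) y -> dY x y <= (size s).+1%:R^-1.
Proof. by have [_ /(_ i)[_ _ _ h] _ _] := hq s; exact: h. Qed.

Let C_catl u s : C (u ++ s) `<=` C s.
Proof. by elim: u => [//|i u IH] /=; exact: subset_trans (@C_sub _ _) IH. Qed.

Let C_disjoint s t : size s = size t -> s != t -> C s `&` C t = set0.
Proof.
elim: s t => [|i s IH] [|j t]//= [/IH{}IH].
rewrite eqseq_cons negb_and => ij; rewrite -subset0 => y [Cs Ct].
have [st|st] := eqVneq s t; last by rewrite -(IH st); split; [exact: C_sub Cs|exact: C_sub Ct].
rewrite st eqxx orbF in ij; rewrite st in Cs.
by have [_ _ /(_ _ _ ij) <- _] := hq t.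
Qed.

(** Either the ancestor of [t] on the level of [s] differs from [s], and the cells are disjoint, or
    [t] lies below [s], where cells avoid [L s]. *)
Let L_disjoint s t : s != t -> L s `&` L t = set0.
Proof.
wlog st : s t / (size s <= size t)%N.
  move=> h; have [|/ltnW ts] := leqP (size s) (size t); first exact: h.
  by rewrite eq_sym setIC; exact: h.
move=> nst; rewrite -subset0 => y [Ls Lt].
(* Nodes list the latest choice first, so [drop k t] is the ancestor of [t] on the level of [s]. *)
pose k := (size t - size s)%N; have tE := cat_take_drop k t.
have sd : size (drop k t) = size s by rewrite size_drop subKn.
have Ct := L_C Lt; rewrite -tE in Ct.
have [sE|sE] := eqVneq s (drop k t); last first.
  by rewrite -(C_disjoint (esym sd) sE); split; [exact: L_C|exact: C_catl Ct].
rewrite -sE in Ct tE; case/lastP: (take k t) tE Ct => [|u i] tE Ct.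
  by rewrite -tE /= eqxx in nst.
by rewrite cat_rcons in Ct; have /C_subD[] := C_catl Ct.
Qed.

Let path (i : nat -> nat) := fix path n := if n is n'.+1 then i n' :: path n' else [::].

Let size_path i n : size (path i n) = n.
Proof. by elim: n => //= n ->. Qed.

Let C_path i m n : (m <= n)%N -> C (path i n) `<=` C (path i m).
Proof.
elim: n => [|n IH]; first by rewrite leqn0 => /eqP ->.
rewrite leq_eqVlt => /predU1P[->//|/IH h]; exact: subset_trans (@C_sub _ _) h.
Qed.

(** Points of the carried pieces cluster at some [y], which lies in all the nested closed cells. The
    prefixes along the path form one Souslin branch [a], and the closed sets along [a] contain [y];
    hence [y] is in [B]. *)
Let path_point i : exists y, B y /\ forall n, C (path i n) y.
Proof.
have /choice[u hu] n : exists y, (souslin_part F (q (path i n)).1 `&` C (path i n)) y.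
  have [_ nJ] := q_big (path i n); apply: contrapT => /forallNP h; apply: nJ.
  apply: JcoverS (Jcover0 mu) => y; exact: h.
have [y uy] := compact_cluster_seq mY u cY.
pose a k := nth 0%N (q (path i k.+1)).1 k.
have qa n : (q (path i n)).1 = mkseq a n.
  elim: n => [|n IH]; first by rewrite /= q0.
  have [_ /(_ (i n))[_ [k qk] _ _] _ _] := hq (path i n).
  by rewrite mkseqS /a /= qk IH nth_rcons size_mkseq ltnn eqxx.
exists y; split=> [|n].
  apply/(proj2 sFB); exists a => k; apply: ((closed_distP mY _).1 (sFB.1 _)) => e e0.
  have [m km ym] := uy e e0 k; exists (u m) => //.
  have [[b [bq Fb]] _] := hu m; have := Fb k.
  suff -> : mkseq b k = mkseq a k by [].
  move: bq; rewrite qa size_mkseq => ba.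
  apply: (@eq_from_nth _ 0%N); rewrite ?size_mkseq// => j jk.
  have jm := leq_trans jk km.
  by rewrite !nth_mkseq// -(nth_mkseq 0%N b jm) -(nth_mkseq 0%N a jm) ba.
apply: ((closed_distP mY _).1 (@closed_C (path i n))) => e e0; have [m nm ym] := uy e e0 n.
by exists (u m) => //; apply: (C_path nm); case: (hu m).
Qed.

Let N := ~` (\bigcup_n E n).

(** A point of [N] avoids every [E n] and so is covered by the sets [U n i]; [seqDU] makes these
    disjoint and the index unique. *)
Let idx_exists : exists idx : X -> nat -> nat, forall x n, N x -> seqDU (U n) (idx x n) x.
Proof.
have /choice[idx hidx] (xn : X * nat) : exists i, N xn.1 -> seqDU (U xn.2) i xn.1.
  have [Nx|nNx] := pselect (N xn.1); last by exists 0%N.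
  have [|i Ui] := @EU xn.2 xn.1; first by move=> Ex; apply: Nx; exists xn.2.
  have : (\bigcup_i U xn.2 i) xn.1 by exists i.
  by rewrite seqDU_bigcup_eq => -[j _ ?]; exists j.
by exists (fun x n => idx (x, n)) => x n; exact: (hidx (x, n)).
Qed.

Let cellX := fix cellX s : set X :=
  if s is i :: s' then cellX s' `&` seqDU (U (size s')) i else setT.

Let measurable_cellX s : measurable (cellX s : set (borel X)).
Proof.
elim: s => [|i s IH] /=; first exact: measurableT.
apply: measurableI => //; apply: measurableD; first exact: open_measurable_borel.
by apply: bigsetU_measurable => j _; exact: open_measurable_borel.
Qed.

Let measurable_N : measurable (N : set (borel X)).
Proof.
apply: measurableC; apply: bigcupT_measurable => n.
exact: closed_measurable_borel.
Qed.

(** On [N], [f x] is a point of the path given by the indices of [x]. The closure in question lies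
    in the null set [N] and the sets [W s] of all nodes, whose measures sum up to at most
    [mu K + 1]. *)
Lemma cell_tree_map : exists f : borel X -> borel Y,
  [/\ measurable_fun [set: borel X] f, forall x, B (f x) &
    forall K : set Y, closed K -> (mu (K : set (borel Y)) < +oo)%E ->
      (nu (closure (f @^-1` K `&` N : set X) : set (borel X)) < +oo)%E].
Proof.
have [idx hidx] := idx_exists.
have [b0 Bb0] : B !=set0.
  by apply/set0P/eqP => B0; apply: nB; rewrite B0; exact: Jcover0.
have /choice[f hf] (x : X) : exists y, [/\ B y,
    N x -> forall n, C (path (idx x) n) y & ~ N x -> y = b0].
  have [Nx|nNx] := pselect (N x); last by exists b0.
  by have [y [By Cy]] := path_point (idx x); exists y.
have cellP x s : N x -> cellX s x <-> s = path (idx x) (size s).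
  move=> Nx; elim: s => [//|i s IH] /=; split=> [[/IH sE si]|[iE sE]].
    congr (_ :: _) => //.
    have /trivIsetP/(_ i (idx x (size s)) I I) := @trivIset_seqDU _ (U (size s)).
    case: eqVneq => // _ /(_ isT) dis.
    suff : set0 x by [].
    by rewrite -dis; split => //; exact: hidx.
  by split; [exact/IH|rewrite {1}iE; exact: hidx].
(* Diameters of cells tend to 0 along a path, so for [x] in [N] the value lies in a closed [A] as
   soon as all cells on the path meet [A]. *)
have f_preimage (A : set Y) : closed A -> f @^-1` A =
    (~` N `&` [set _ | A b0]) `|`
    (N `&` \bigcap_n \bigcup_(s in [set s | size s = n /\ C s `&` A !=set0]) cellX s).
  move=> cA; apply/seteqP; split => [x /= Ax|x [[nNx Ab0]|[Nx h]]].
  - have [_ fC fb0] := hf x; have [Nx|nNx] := pselect (N x); [right|left].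
      split => // n _; exists (path (idx x) n).
        by split; [exact: size_path|exists (f x); split => //; exact: fC].
      by apply/(cellP _ _ Nx); rewrite size_path.
    by split => //=; rewrite -fb0.
  - by have [_ _ /(_ nNx)] := hf x => /= ->.
  have [_ /(_ Nx) fC _] := hf x.
  apply: ((closed_distP mY _).1 cA) => e /invS_small[m /(_ _ (leqnn m)) me].
  have [s [ss [y [Cy Ay]]] /(cellP _ _ Nx) sE] := h m.+1 I.
  exists y => //; rewrite sE ss in Cy.
  by apply: le_lt_trans me; have := C_diam (fC m.+1) Cy; rewrite size_path.
exists f; split=> [|x|K cK Koo]; [|by case: (hf x)|].
  have mfC (A : set Y) : closed A -> measurable (f @^-1` A : set (borel X)).
    move=> cA; rewrite f_preimage//; apply: measurableU.
      apply: measurableI; first exact: measurableC.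
      have [h|h] := pselect (A b0).
        by rewrite (_ : [set _ | _] = setT); [exact: measurableT|apply/seteqP; split].
      by rewrite (_ : [set _ | _] = set0)//; apply/seteqP; split.
    apply: measurableI => //; apply: bigcapT_measurable => n.
    exact: (@bigcup_countType_measurable _ (borel X) (seq nat)).
  apply: (@measurability _ _ (borel X) (borel Y) setT f (@open Y)) => // _ [A oA <-].
  rewrite setTI -[A]setCK preimage_setC; apply: measurableC.
  by apply: (mfC (~` A)); exact: open_closedC.
pose A := f @^-1` K `&` N.
have /choice[W hW] s := let: And4 _ _ _ h := hq s in h K cK.
have mW s : measurable (W s) by case: (hW s).
have hit s x : (A `&` cellX s) x -> K `&` C s !=set0.
  move=> [[Kfx Nx] /(cellP _ _ Nx) sx]; exists (f x); split => //.
  by rewrite sx; have [_ h _] := hf x; exact: h.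
(* If [z] is in [E (size s)], it is off the closures of the first [m] balls, so nearby points have
   indices at least [m] and [z] is in [W s]. Otherwise [z] is in some [U (size s) m], where indices
   are at most [m], and one of finitely many closures contains [z]. *)
have descend s z : closure (A `&` cellX s) z -> ~ W s z ->
    ~ E (size s) z /\ exists i, closure (A `&` cellX (i :: s)) z.
  move=> clz nWz; have nEz : ~ E (size s) z.
    move=> Ez; apply: nWz; have [_ _ h] := hW s; apply: h => // c m c0.
    have : open (~` \bigcup_(i < m) closure (U (size s) i)).
      apply: closed_openC; apply: closed_bigcup; first exact: finite_II.
      by move=> i _; exact: closed_closure.
    move=> /(open_distP mX)/(_ z)[|c' c'0 hc'].
      by move=> [i _ Uz]; have : (closure (U (size s) i) `&` E (size s)) z by []; rewrite clUE.
    (* [c / 2] makes up for the factor 2 in [pU]. *)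
    have [|w [Aw sw]] := (closure_distP mX _ _).1 clz (Num.min (c / 2) c').
      by rewrite lt_min c'0 divr_gt0.
    rewrite lt_min => /andP[zw zw'].
    have iw := hidx w (size s) Aw.2.
    have Uw : U (size s) (idx w (size s)) w by case: iw.
    exists (idx w (size s)); split.
    - rewrite leqNgt; apply/negP => im; apply: (hc' w zw').
      by exists (idx w (size s)) => //; exact: subset_closure.
    - by rewrite (le_lt_trans (pU Ez Uw))// mulrC -ltr_pdivlMr.
    - by apply: (hit _ w); split.
  split => //; have [m Um] := EU nEz.
  pose G := \bigcup_(i < m.+1) closure (A `&` cellX (i :: s)).
  have cG : closed G.
    apply: closed_bigcup; first exact: finite_II.
    by move=> i _; exact: closed_closure.
  have [[i _ ?]|nGz] := pselect (G z); first by exists i.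
  have /(_ _ (open_nbhs_nbhs (conj (openI (closed_openC cG) (oU (size s) m)) _))) := clz.
  case; first by [].
  move=> w [[Aw sw] [nGw Uw]]; exfalso; apply: nGw.
  have iw := hidx w (size s) Aw.2; exists (idx w (size s)).
    rewrite /= ltnS leqNgt; apply/negP => mi; have [_] := iw; apply.
    by rewrite -bigcup_mkord; exists m.
  by apply: subset_closure; split.
(* A point of no [W s] descends through all levels and thus avoids every [E n]. *)
have clA : closure A `<=` N `|` \bigcup_s W s.
  move=> z clz; have [|nWz] := pselect ((\bigcup_s W s) z); [by right|left].
  have nW s : ~ W s z by move=> Wz; apply: nWz; exists s.
  have cl n : exists2 s, size s = n & closure (A `&` cellX s) z.
    elim: n => [|n [s <- cls]]; first by exists [::]; rewrite //= setIT.
    by have [_ [i ?]] := descend _ _ cls (nW s); exists (i :: s).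
  by move=> [n _]; have [s <- /descend[]] := cl n.
pose Wn n : set (borel X) := if @pickle_inv (seq nat) n is Some s then W s else set0.
pose Ln n : set (borel Y) := if @pickle_inv (seq nat) n is Some s then K `&` L s else set0.
have mWn n : measurable (Wn n) by rewrite /Wn; case: pickle_inv.
have mLn n : measurable (Ln n).
  rewrite /Ln; case: pickle_inv => // s.
  by apply: closed_measurable_borel; apply: closedI.
have mK : measurable (K : set (borel Y)) by exact: closed_measurable_borel.
have mA : measurable (closure A : set (borel X)).
  by apply: closed_measurable_borel; exact: closed_closure.
have triv : trivIset setT Ln.
  apply/trivIsetP => i j _ _; rewrite /Ln => ij.
  have := @pickle_invK (seq nat) i; have := @pickle_invK (seq nat) j.
  case: (pickle_inv i) => [s|]; last by rewrite set0I.
  case: (pickle_inv j) => [t|]; last by rewrite setI0.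
  move=> /= tj si; have st : s != t by apply: contra_neq ij => st; rewrite -si -tj st.
  by rewrite setIACA L_disjoint// setI0.
have WL n : (nu (Wn n) <= mu (Ln n) + (1 / (2 ^ n.+1)%:R)%:E)%E.
  have := @pickle_invK (seq nat) n; rewrite /Wn /Ln.
  case: pickle_inv => [s /= <-|_]; first by case: (hW s).
  by rewrite !measure0 add0e lee_fin divr_ge0.
apply: (@le_lt_trans _ _ (nu (N : set (borel X)) + nu (\bigcup_n Wn n))%E).
  apply: le_trans (measureU2 _ _ _) => //; last exact: bigcupT_measurable.
  apply: mu_subset => //.
    by apply: measurableU => //; exact: bigcupT_measurable.
  move=> z /clA[Nz|[s _ Wz]]; [by left|right].
  by exists (pickle s) => //; rewrite /Wn pickleK_inv.
rewrite [X in (X + _)%E]E0 add0e.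
apply: (@le_lt_trans _ _ (\sum_(n <oo) (mu (Ln n) + (1 / (2 ^ n.+1)%:R)%:E))%E).
  apply: (@le_trans _ _ (\sum_(n <oo) nu (Wn n))%E).
    by apply: measure_sigma_subadditive => //; exact: bigcupT_measurable.
  by apply: lee_nneseries.
(* The errors sum up to 1, and the disjoint sets [Ln n] lie in [K]. *)
apply: le_lt_trans (epsilon_trick _ _ _) _ => //.
rewrite -measure_semi_bigcup//; last exact: bigcupT_measurable.
rewrite lte_add_pinfty ?ltry// (le_lt_trans _ Koo)// mu_subset//.
  exact: bigcupT_measurable.
by move=> y [n _]; rewrite /Ln; case: pickle_inv => // s [].
Qed.

End cell_tree.

Theorem proposition7p1 (R : realType) (X Y : ptopologicalType)
    (nu : {measure set (borel X) -> \bar R})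
    (mu : {measure set (borel Y) -> \bar R})
    (cX : compactum R X) (cY : compactum R Y)
    (nu_sigma_finite : sigma_finite [set: borel X] nu)
    (nu_nonatomic : nonatomic nu)
    (nu_open : forall U : set X, open U -> U !=set0 -> (0 < nu U)%E)
    (mu_nonatomic : nonatomic mu)
    (Y_notin_Jf : ~ Jf mu [set: borel Y]) :
  forall B : set (borel Y), measurable B -> ~ Jf mu B -> (mu B < +oo)%E ->
    exists f : borel X -> borel Y,
      [/\ measurable_fun [set: borel X] f,
          forall x, B (f x)
        & forall A : set (borel Y), Jf mu A -> Jf nu (f @^-1` A)].
Proof.
move=> B mB nB _; have [{}cX [dX mX]] := cX; have [{}cY [dY mY]] := cY.
have {}nB : ~ Jcover mu B by move=> JB; apply: nB; apply/(JfE mY cY).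
have [F sFB] := borel_souslin mY cY mB.
have [E [cE E0]] := sigma_finite_closed mX cX nu_sigma_finite.
have /choice[pU hpU] n : exists pU : (nat -> X) * (nat -> set X),
    [/\ forall i, open (pU.2 i), forall x, ~ E n x -> exists i, pU.2 i x,
    forall i, closure (pU.2 i) `&` E n = set0 &
    forall i z w, E n z -> pU.2 i w -> dX z (pU.1 i) <= 2 * dX z w].
  by have [p [U h]] := whitney_cover mX cX (proj1 (cE n)); exists (p, U).
pose p n := (pU n).1.
pose spec s := node_spec dX dY nu mu F (E (size s)) (p (size s))
  (1 / (2 ^ (@pickle (seq nat) s).+1)%:R) (size s).+1%:R^-1.
(* Node data are chosen for every pair of a node and a cell, with a dummy value when the cell is not
   big, so that the tree [q] can be defined by recursion before its cells are shown to be big. *)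
have /choice[nd hnd] (t : seq nat * (seq nat * set Y)) :
    exists Lch, big_cell mu F t.2 -> spec t.1 t.2 Lch.1 Lch.2.
  have [big|nbig] := pselect (big_cell mu F t.2); last by exists (set0, fun=> t.2).
  have [||Lch h] := @node_exists R X Y dX dY mX cX mY cY nu mu nu_nonatomic
    mu_nonatomic F (E (size t.1)) (p (size t.1))
    (1 / (2 ^ (@pickle (seq nat) t.1).+1)%:R) (size t.1).+1%:R^-1 t.2
    (proj1 (cE _)) (proj2 (cE _)) _ _ big.
  - by rewrite divr_gt0// ltr0n expn_gt0.
  - by [].
  - by exists Lch.
pose fix q s : seq nat * set Y := if s is i :: s' then (nd (s', q s')).2 i else ([::], setT).
have q_big s : big_cell mu F (q s).
  elim: s => [|i s IH]; first exact: big_cell_root sFB nB.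
  by have [_ /(_ i)[]] := hnd (s, q s) IH.
have [|||||f [mf fB hf]] := @cell_tree_map R X Y dX dY mX mY cY nu mu F B sFB E p
  (fun n => (pU n).2) _ E0 _ _ _ _ q (fun s => (nd (s, q s)).1) erefl
  (fun s => hnd (s, q s) (q_big s)) nB.
- by move=> n; case: (cE n).
- by move=> n; case: (hpU n).
- by move=> n; case: (hpU n).
- by move=> n; case: (hpU n).
- by move=> n; case: (hpU n).
exists f; split => // A /(JfE mY cY)[mA [K [hK AK]]]; apply/(JfE mX cX); split.
  by rewrite -[_ @^-1` _]setTI; exact: mf.
pose N := ~` \bigcup_n E n.
(* The preimage is covered by the [E n] and, on their complement [N], by one closed set of finite
   measure for each [K n]. *)
apply: (@JcoverS _ _ _ _ (\bigcup_n E n `|` \bigcup_n closure (f @^-1` (K n) `&` N))).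
  move=> x /AK[n _ Kx]; have [|nEx] := pselect ((\bigcup_n E n) x); [by left|right].
  by exists n => //; apply: subset_closure.
apply: JcoverU; apply: Jcover_bigcup => n.
  by apply: Jcover_closed; case: (cE n).
apply: Jcover_closed; first exact: closed_closure.
by have [cK Koo] := hK n; exact: hf.
Qed.
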